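(* Let $n\geqslant 1$ be an integer, $p>1$, $\mu\geqslant 0$ and $\nu^2\geqslant 0$, and let $\delta:=(\mu-1)^2-4\nu^2\in\mathbb{R}$ (no sign condition on $\delta$ is imposed). Consider the Cauchy problem $$\begin{cases}u_{tt}-\Delta u+\dfrac{\mu}{1+t}u_t+\dfrac{\nu^2}{(1+t)^2}u=|u_t|^p, & x\in\mathbb{R}^n,\ t>0,\\ u(0,x)=\varepsilon u_0(x),\ u_t(0,x)=\varepsilon u_1(x), & x\in\mathbb{R}^n.\end{cases}$$ Suppose that $(u_0,u_1)\in H^1(\mathbb{R}^n)\times L^2(\mathbb{R}^n)$ are nonnegative and compactly supported, not both identically zero, with $\operatorname{supp}u_0\cup\operatorname{supp}u_1\subset B_R$ for some $R>0$. For $\varepsilon>0$, let $u$ be a local in-time energy solution to this problem, with lifespan $T_\varepsilon$. (i) If $n+\mu>1$ and $1<p\leqslant p_{\mathrm{Gla}}(n+\mu)$, then $T_\varepsilon<\infty$ for every $\varepsilon>0$. Moreover, for every sufficiently small $\varepsilon>0$, $$T_\varepsilon\leqslant\begin{cases}C\varepsilon^{-\frac{2(p-1)}{2-(n+\mu-1)(p-1)}} & \text{if } 1<p<p_{\mathrm{Gla}}(n+\mu),\\ \exp\big(C\varepsilon^{-(p-1)}\big) & \text{if } p=p_{\mathrm{Gla}}(n+\mu).\end{cases}$$ (ii) If $n=1$ and $\mu=0$, then $T_\varepsilon<\infty$ for every $p>1$ and every $\varepsilon>0$. Moreover, for every sufficiently small $\varepsilon>0$, $$T_\varepsilon\leqslant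 C\varepsilon^{-(p-1)}.$$ Here the constant $C>0$ is independent of $\varepsilon$.
   Context: $B_r$ denotes the open ball in $\mathbb{R}^n$ centered at the origin with radius $r$. The Glassey exponent is $p_{\mathrm{Gla}}(d):=1+\frac{2}{d-1}$ for real $d>1$. Energy solution. Write $b(t)=\frac{\mu}{1+t}$ and $m(t)=\frac{\nu^2}{(1+t)^2}$. Let $T>0$. A function $u\in C([0,T),H^1(\mathbb{R}^n))\cap C^1([0,T),L^2(\mathbb{R}^n))$ with $u_t\in L^p_{\mathrm{loc}}([0,T)\times\mathbb{R}^n)$ is called a local in-time energy solution on $[0,T)$ if $\operatorname{supp}u(t,\cdot)\subset B_{R+t}$ for every $t\in[0,T)$, the initial conditions $u(0,\cdot)=\varepsilon u_0$, $u_t(0,\cdot)=\varepsilon u_1$ hold in $H^1\times L^2$, and for every $t\in[0,T)$ and every $\Phi\in C_0^\infty([0,T)\times\mathbb{R}^n)$, $$\int_{\mathbb{R}^n}u_t(t,x)\Phi(t,x)\,\mathrm{d}x-\varepsilon\int_{\mathbb{R}^n}u_1(x)\Phi(0,x)\,\mathrm{d}x-\int_0^t\!\int_{\mathbb{R}^n}u_t\Phi_s\,\mathrm{d}x\,\mathrm{d}s+\int_0^t\!\int_{\mathbb{R}^n}\nabla u\cdot\nabla\Phi\,\mathrm{d}x\,\mathrm{d}s+\int_0^t\!\int_{\mathbb{R}^n}\big(b(s)u_t+m(s)u\big)\Phi\,\mathrm{d}x\,\mathrm{d}s=\int_0^t\!\int_{\mathbb{R}^n}|u_t|^p\Phi\,\mathrm{d}x\,\mathrm{d}s.$$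 The lifespan $T_\varepsilon\in(0,\infty]$ of $u$ is its maximal continuation time within this class of energy solutions; $u$ is regarded as defined on $[0,T_\varepsilon)$. *)

(* Defs.v *)
From HB Require Import structures.
From mathcomp Require Import all_boot all_order all_algebra.
From mathcomp Require Import all_classical all_reals all_analysis.

Set Implicit Arguments.
Unset Strict Implicit.
Unset Printing Implicit Defensive.

Import Order.TTheory GRing.Theory Num.Theory.
Import numFieldNormedType.Exports.

Local Open Scope classical_set_scope.
Local Open Scope ring_scope.

(* The sigma-algebra generated by the coordinates, i.e. the Borel sets. *)
Section borel_rV.
Variables (R : realType) (n : nat).

Let coor (i : 'I_n) (x : 'rV[R]_n) : R := x ord0 i.

Let rV_set0 : g_sigma_preimage coor set0.
Proof. exact: sigma_algebra0. Qed.

Let rV_setC A : g_sigma_preimage coor A -> g_sigma_preimage coor (~` A).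
Proof. exact: sigma_algebraC. Qed.

Let rV_bigcup (F : (set 'rV[R]_n)^nat) :
  (forall i, g_sigma_preimage coor (F i)) ->
  g_sigma_preimage coor (\bigcup_i F i).
Proof. exact: sigma_algebra_bigcup. Qed.

HB.instance Definition _ := @isMeasurable.Build default_measure_display
  'rV[R]_n (g_sigma_preimage coor) rV_set0 rV_setC rV_bigcup.

Lemma measurable_rV_coord (i : 'I_n) :
  measurable_fun [set: 'rV[R]_n] (fun x : 'rV[R]_n => x ord0 i).
Proof.
move=> _ Y mY; rewrite setTI; apply: sub_sigma_algebra => /=.
rewrite -bigcup_seq/=; exists i => /=; first by rewrite mem_index_enum.
by exists Y => //; rewrite setTI.
Qed.

Lemma measurable_fun_rVP d (T : measurableType d) (f : T -> 'rV[R]_n) :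
  (forall i, measurable_fun [set: T] (fun t => f t ord0 i)) ->
  measurable_fun [set: T] f.
Proof.
move=> mf _ A mA; rewrite setTI.
have : g_sigma_preimage (fun i => coor i \o f) (f @^-1` A).
  by rewrite g_sigma_preimage_comp; exists A => //; rewrite setTI.
apply: smallest_sub; first exact: sigma_algebra_measurable.
rewrite -bigcup_seq => B [i /= _] [C mC <-].
exact: mf.
Qed.

End borel_rV.

Section lebesgue_rV_step.
Variables (R : realType) (n : nat).
Variable m : {sigma_finite_measure set 'rV[R]_n -> \bar R}.

Definition rV_cons (z : measurableTypeR R * 'rV[R]_n) : 'rV[R]_n.+1 :=
  row_mx (z.1)%:M z.2 : 'rV[R]_(1 + n).

Definition rV_uncons (x : 'rV[R]_n.+1) : measurableTypeR R * 'rV[R]_n :=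
  (x ord0 ord0, \row_j x ord0 (lift ord0 j)).

Lemma rV_cons0 z : rV_cons z ord0 ord0 = z.1.
Proof.
rewrite /rV_cons (_ : ord0 = lshift n (ord0 : 'I_1)); last exact: val_inj.
by rewrite (@row_mxEl R 1 1 n) mxE eqxx mulr1n.
Qed.

Lemma rV_consS z j : rV_cons z ord0 (lift ord0 j) = z.2 ord0 j.
Proof.
rewrite /rV_cons (_ : lift ord0 j = rshift 1 j); last exact: val_inj.
by rewrite (@row_mxEr R 1 1 n).
Qed.

Lemma rV_unconsK : cancel rV_uncons rV_cons.
Proof.
move=> x; apply/rowP => i; case: (unliftP ord0 i) => [j|] ->.
  by rewrite rV_consS mxE.
by rewrite rV_cons0.
Qed.

Lemma rV_consK : cancel rV_cons rV_uncons.
Proof.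
move=> [a v]; rewrite /rV_uncons rV_cons0; congr pair.
by apply/rowP => j; rewrite mxE rV_consS.
Qed.

Lemma measurable_rV_cons : measurable_fun [set: measurableTypeR R * 'rV[R]_n] rV_cons.
Proof.
apply: measurable_fun_rVP => i; case: (unliftP ord0 i) => [j|] ->.
  rewrite (_ : (fun _ => _) = (fun x : 'rV[R]_n => x ord0 j) \o snd).
    by apply: measurableT_comp => //; exact: measurable_rV_coord.
  by apply/funext => z /=; rewrite rV_consS.
rewrite (_ : (fun _ => _) = fst)//.
by apply/funext => z /=; rewrite rV_cons0.
Qed.

Lemma measurable_rV_uncons : measurable_fun [set: 'rV[R]_n.+1] rV_uncons.
Proof.
apply: measurable_fun_pair; first exact: measurable_rV_coord.
apply: measurable_fun_rVP => j.
rewrite (_ : (fun _ => _) = (fun x : 'rV[R]_n.+1 => x ord0 (lift ord0 j))).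
  exact: measurable_rV_coord.
by apply/funext => x /=; rewrite mxE.
Qed.

Definition lebesgue_rVS : set 'rV[R]_n.+1 -> \bar R :=
  pushforward (lebesgue_measure \x m)%E rV_cons.

Let lebesgue_rVS0 : lebesgue_rVS set0 = 0%E.
Proof. by rewrite /lebesgue_rVS /pushforward preimage_set0 measure0. Qed.

Let lebesgue_rVS_ge0 A : (0 <= lebesgue_rVS A)%E.
Proof. exact: (measure_ge0 (lebesgue_measure \x m)%E). Qed.

Let lebesgue_rVS_sigma_additive : semi_sigma_additive lebesgue_rVS.
Proof.
pose mu := measure_function_pushforward__canonical__measure_function_Measure.
exact: (@measure_semi_sigma_additive _ _ _
  (mu _ _ _ _ _ (lebesgue_measure \x m)%E _ measurable_rV_cons)).
Qed.

HB.instance Definition _ := isMeasure.Build _ _ _ lebesgue_rVS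
  lebesgue_rVS0 lebesgue_rVS_ge0 lebesgue_rVS_sigma_additive.

Let lebesgue_rVS_sigma_finite : sigma_finite setT lebesgue_rVS.
Proof.
pose mu1 : {sigma_finite_measure set (measurableTypeR R) -> \bar R} :=
  lebesgue_measure.
have /sigma_finiteP[F [FT ndF Foo]] := sigma_finiteT mu1.
have /sigma_finiteP[G [GT ndG Goo]] := sigma_finiteT m.
exists (fun k => rV_uncons @^-1` (F k `*` G k)).
  apply/seteqP; split => // x _.
  have [i _ Fi] : (\bigcup_k F k) (rV_uncons x).1 by rewrite -FT.
  have [j _ Gj] : (\bigcup_k G k) (rV_uncons x).2 by rewrite -GT.
  exists (maxn i j) => //; split.
    by move: Fi; exact/subsetPset/ndF/leq_maxl.
  by move: Gj; exact/subsetPset/ndG/leq_maxr.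
move=> k; have [mF Fk] := Foo k; have [mG Gk] := Goo k; split.
  rewrite -[X in measurable X]setTI; apply: measurable_rV_uncons => //.
  exact: measurableX.
rewrite /lebesgue_rVS /pushforward -comp_preimage.
rewrite (_ : rV_uncons \o rV_cons = id); last first.
  by apply/funext => z; exact: rV_consK.
rewrite preimage_id product_measure1E//.
by rewrite lte_mul_pinfty// ge0_fin_numE.
Qed.

HB.instance Definition _ := Measure_isSigmaFinite.Build _ _ _ lebesgue_rVS
  lebesgue_rVS_sigma_finite.

End lebesgue_rV_step.

Fixpoint lebesgue_rV (R : realType) (n : nat) :
    {sigma_finite_measure set 'rV[R]_n -> \bar R} :=
  match n with
  | 0 => \d_(0 : 'rV[R]_0)
  | n'.+1 => lebesgue_rVS (lebesgue_rV R n')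
  end.

Lemma lebesgue_rV_box (R : realType) (n : nat) (A : 'I_n -> set R) :
  (forall i, measurable (A i)) ->
  lebesgue_rV R n [set x | forall i, A i (x ord0 i)] =
  (\prod_(i < n) lebesgue_measure (A i))%E.
Proof.
elim: n A => [|n IH] A mA.
  rewrite big_ord0 /= diracE mem_set//= => -[].
  by [].
rewrite big_ord_recl -IH//= /lebesgue_rVS /pushforward.
pose B := [set x : 'rV[R]_n | forall i, A (lift ord0 i) (x ord0 i)].
rewrite (_ : _ @^-1` _ = A ord0 `*` B).
  rewrite product_measure1E//; first exact: mA.
  rewrite (_ : B = \bigcap_(i in [set: 'I_n]) 
      ((fun x : 'rV[R]_n => x ord0 i) @^-1` A (lift ord0 i))).
    apply: fin_bigcap_measurable => // i _.
    rewrite -[X in measurable X]setTI.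
    by apply: measurable_rV_coord => //; exact: mA.
  by apply/seteqP; split => x /= h i; [move=> _; exact: h | exact: h].
apply/seteqP; split => z /=.
  move=> h; split => [|i].
    by have := h ord0; rewrite rV_cons0.
  by have := h (lift ord0 i); rewrite rV_consS.
move=> [h0 hS] i; case: (unliftP ord0 i) => [j|] ->.
  by rewrite rV_consS; exact: hS.
by rewrite rV_cons0.
Qed.

Section function_spaces.
Variables (R : realType) (n : nat).
Local Notation space := 'rV[R]_n.
Local Notation lebn := (lebesgue_rV R n).

Definition euclidean_norm (x : space) : R :=
  Num.sqrt (\sum_(i < n) x ord0 i ^+ 2).

Definition open_ball (r : R) : set space := [set x | euclidean_norm x < r].

(* The support of a class of functions modulo a.e. equality. *)
Definition ess_support (f : space -> R) : set space :=
  ~` [set x | exists2 U, nbhs x U & {ae lebn, forall y, U y -> f y = 0}].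

Definition iter_derive (V : normedModType R) (vs : seq V) (f : V -> R) :
    V -> R :=
  foldr (fun v g => 'D_v g) f vs.

Definition smooth (V : normedModType R) (f : V -> R) : Prop :=
  forall vs : seq V, continuous (iter_derive vs f) /\
    forall x v, derivable (iter_derive vs f) x v.

Definition test_function (phi : space -> R) : Prop :=
  smooth phi /\
  exists K : set space, compact K /\ forall x, ~ K x -> phi x = 0.

Definition basis_vec (i : 'I_n) : space := delta_mx ord0 i.

Definition is_weak_gradient (f : space -> R) (G : 'I_n -> space -> R) : Prop :=
  forall i, G i \in Lfun lebn 2%:E /\
    forall phi, test_function phi ->
      \int[lebn]_x (f x * 'D_(basis_vec i) phi x) =
      - \int[lebn]_x (G i x * phi x).

Definition H1 (f : space -> R) : Prop :=
  f \in Lfun lebn 2%:E /\ exists G, is_weak_gradient f G.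

(* Unique up to a.e. equality; meaningful for [f] in [H1]. *)
Definition weak_gradient (f : space -> R) : 'I_n -> space -> R :=
  xget (fun _ _ => 0) [set G | is_weak_gradient f G].

Definition L2norm (f : space -> R) : \bar R := ('N[lebn]_2%:E [EFin \o f])%E.

Definition H1norm (f : space -> R) : \bar R :=
  ((L2norm f `^ 2 + \sum_(i < n) L2norm (weak_gradient f i) `^ 2) `^ 2^-1)%E.

Definition continuous_in_norm (N : (space -> R) -> \bar R) (I : set R)
    (u : R -> space -> R) : Prop :=
  forall t, I t -> N (u s \- u t) @[s --> within I (nbhs t)] --> 0%E.

(* One-sided at the endpoints of [I]. *)
Definition L2_derivative (I : set R) (u ut : R -> space -> R) : Prop :=
  forall t, I t ->
    L2norm (fun x => (u s x - u t x) / (s - t) - ut t x)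
      @[s --> within (I `\ t) (nbhs t)] --> 0%E.

End function_spaces.

Section energy_solutions.
Variables (R : realType) (n : nat).
Local Notation space := 'rV[R]_n.
Local Notation spacetime := (R * space)%type.
Local Notation leb1 := (@lebesgue_measure R).
Local Notation lebn := (lebesgue_rV R n).

Definition time_itv (T : \bar R) : set R := [set t | 0 <= t /\ (t%:E < T)%E].

(* [C_0^oo([0,T) x R^n)], test functions not having to vanish at [t = 0]: only
   the values of [Phi] on [time_itv T] matter, and [Phi] being smooth up to
   [t = 0] means that it has a smooth extension to negative times. *)
Definition spacetime_test_function (T : \bar R) (Phi : spacetime -> R) : Prop :=
  smooth Phi /\
  exists K : set spacetime,
    [/\ compact K, K `<=` time_itv T `*` setT
      & forall z, time_itv T z.1 -> ~ K z -> Phi z = 0].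

Definition dt (Phi : spacetime -> R) (t : R) (x : space) : R :=
  'D_((1, 0) : spacetime) Phi (t, x).

Definition dx (i : 'I_n) (Phi : spacetime -> R) (t : R) (x : space) : R :=
  'D_((0, basis_vec R i) : spacetime) Phi (t, x).

Definition Lp_loc (p : R) (T : \bar R) (v : R -> space -> R) : Prop :=
  measurable_fun (time_itv T `*` setT : set (measurableTypeR R * space))
    (fun z => v z.1 z.2) /\
  forall K : set spacetime, compact K -> K `<=` time_itv T `*` setT ->
    (\int[leb1 \x lebn]_(z in K) (`|v z.1 z.2| `^ p)%:E < +oo)%E.

Section problem.
Variables (p mu nu rad eps : R) (u0 u1 : space -> R).

Definition damping (t : R) : R := mu / (1 + t).
Definition mass (t : R) : R := nu ^+ 2 / (1 + t) ^+ 2.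

Definition weak_identity (T : \bar R) (u ut : R -> space -> R) : Prop :=
  forall (t : R) (Phi : spacetime -> R),
    time_itv T t -> spacetime_test_function T Phi ->
    \int[lebn]_x (ut t x * Phi (t, x))
    - eps * \int[lebn]_x (u1 x * Phi (0, x))
    - \int[leb1]_(s in `[0, t]) \int[lebn]_x (ut s x * dt Phi s x)
    + \int[leb1]_(s in `[0, t]) \int[lebn]_x
        (\sum_(i < n) weak_gradient (u s) i x * dx i Phi s x)
    + \int[leb1]_(s in `[0, t]) \int[lebn]_x
        ((damping s * ut s x + mass s * u s x) * Phi (s, x))
    = \int[leb1]_(s in `[0, t]) \int[lebn]_x (`|ut s x| `^ p * Phi (s, x)).

(* Functions of [x] are representatives of classes modulo a.e. equality; every
   continuous map into [L^2] has a jointly measurable representative, which is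
   the one that [Lp_loc] is about. *)
Record energy_solution_with (T : \bar R) (u ut : R -> space -> R) : Prop := {
  energy_H1 : forall t, time_itv T t -> H1 (u t) ;
  energy_H1_cont : continuous_in_norm (@H1norm R n) (time_itv T) u ;
  energy_L2 : forall t, time_itv T t -> ut t \in Lfun lebn 2%:E ;
  energy_L2_cont : continuous_in_norm (@L2norm R n) (time_itv T) ut ;
  energy_deriv : L2_derivative (time_itv T) u ut ;
  energy_Lp_loc : Lp_loc p T ut ;
  energy_support : forall t, time_itv T t ->
    ess_support (u t) `<=` open_ball (rad + t) ;
  energy_init0 : {ae lebn, forall x, u 0 x = eps * u0 x} ;
  energy_init1 : {ae lebn, forall x, ut 0 x = eps * u1 x} ;
  energy_weak : weak_identity T u ut }.

(* The time derivative [ut] is determined by [u] up to a.e. equality. *)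
Definition energy_solution (T : \bar R) (u : R -> space -> R) : Prop :=
  (0 < T)%E /\ exists ut, energy_solution_with T u ut.

Definition has_lifespan (u : R -> space -> R) (T : \bar R) : Prop :=
  energy_solution T u /\
  forall (T' : \bar R) (v : R -> space -> R), energy_solution T' v ->
    (forall t, time_itv T t -> {ae lebn, forall x, v t x = u t x}) ->
    (T' <= T)%E.

End problem.
End energy_solutions.

Definition glassey (R : realType) (d : R) : R := 1 + 2 / (d - 1).

(* Main.v *)
(* Test the equation against the plane wave [expR (lam * x_0)], cut off away from
   the support of the solution, where [lam ^+ 2 = nu ^+ 2 + 2 + mu], and put
   [F = int u psi], [G = int ut psi]. The equation becomes
     [F' = G],  [G' = - mu / (1 + s) * G + (lam ^+ 2 - nu ^+ 2 / (1 + s) ^+ 2) * F + N],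
   with [N = int |ut| ^ p psi >= V ^ (1 - p) * |G| ^ p] by Jensen's inequality, [V]
   being the mass of the wave on the ball that contains the support:
   [V <= K * expR (lam * s) * (1 + s) ^ ((n - 1) / 2)]. As [lam] is so large, no sign
   of [delta] is needed: [F] and [G] stay nonnegative, [G] dominates a multiple of
   [G + (lam + mu / (2 * (1 + s))) * F] for [s >= 1], and this combination,
   renormalized to [z], satisfies [z' >= c * (1 + s) ^ (- theta) * z ^ p] with
   [theta = (n - 1 + mu) * (p - 1) / 2]. Integrating [z ^ (- p) * z'] bounds the
   integral of [(1 + s) ^ (- theta)] up to the lifespan by a multiple of
   [eps ^ (- (p - 1))]; this integral diverges exactly when [theta <= 1]. *)

Require Import Defs.
From HB Require Import structures.
From mathcomp Require Import all_boot all_order all_algebra.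
From mathcomp Require Import all_classical all_reals all_analysis.
From mathcomp Require Import measurable_realfun ring lra.

Set Implicit Arguments.
Unset Strict Implicit.
Unset Printing Implicit Defensive.

Import Order.TTheory GRing.Theory Num.Theory.
Import numFieldNormedType.Exports.

Local Open Scope classical_set_scope.
Local Open Scope ring_scope.

(** * Ordinary differential inequalities *)

(** The obstacle is regularity. An energy solution satisfies the equation only integrated in time,
    so [G] is merely continuous, and no support property of [ut] is assumed. The system is therefore
    treated for differentiable functions and with inequalities, and reached from an integral
    inequality by comparison from below. This asks for a right-hand side that is monotone in both
    unknowns: hence the factor [expR (mu * s)] of the test function, and [lam ^+ 2 >= nu ^+ 2]. The
    localization of [ut] is recovered from the difference quotients of [u], at the price of 1 in the
    radius. The excess [2 + mu] in [lam ^+ 2] pays for [(1 - r) * F <= G] with [r = 1 / (1 + s)],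
    which lets [G] control [F]. The power [theta] has two sources: [(n - 1) / 2] comes from the
    concentration of the plane wave near the pole of the ball, [mu / 2] from the linear growth
    [expR (lam * s) * (1 + s) ^ (- mu / 2)]. The exponentials in Jensen's constant and in the
    renormalization cancel exactly, so that only this power decides. *)

Section real_calculus.
Variable R : realType.
Implicit Types (f g : R -> R) (x a b : R).

Lemma is_derive_add f g x df dg : is_derive x (1 : R) f df ->
  is_derive x 1 g dg -> is_derive x 1 (fun s => f s + g s) (df + dg).
Proof. exact: is_deriveD. Qed.

Lemma is_derive_mul f g x df dg : is_derive x (1 : R) f df ->
  is_derive x 1 g dg -> is_derive x 1 (fun s => f s * g s) (df * g x + f x * dg).
Proof.
move=> hf hg; apply: (is_derive_eq (is_deriveM hf hg)).
by rewrite /GRing.scale /= addrC mulrC.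
Qed.

Lemma is_derive_mulc (c : R) f x df : is_derive x (1 : R) f df ->
  is_derive x 1 (fun s => c * f s) (c * df).
Proof.
move=> hf; apply: (is_derive_eq (is_derive_mul (is_derive_cst c x 1) hf)).
by rewrite mul0r add0r.
Qed.

Lemma is_derive_addcl (c : R) f x df : is_derive x (1 : R) f df ->
  is_derive x 1 (fun s => c + f s) df.
Proof.
move=> hf; apply: (is_derive_eq (is_derive_add (is_derive_cst c x 1) hf)).
by rewrite add0r.
Qed.

Lemma is_derive_expR_comp f x df : is_derive x (1 : R) f df ->
  is_derive x 1 (fun s => expR (f s)) (expR (f x) * df).
Proof.
move=> hf; apply: (is_derive_eq (is_derive1_comp (is_derive_expR (f x)) hf)).
by [].
Qed.

Lemma is_derive_ln1 x : -1 < x -> is_derive x (1 : R) (fun s => ln (1 + s)) (1 + x)^-1.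
Proof.
move=> x1; have h : 0 < 1 + x by lra.
by apply: (is_derive_eq (is_derive1_comp (is_derive1_ln h) (is_derive_addcl 1 (is_derive_id x 1)))); rewrite mulr1.
Qed.

Lemma is_derive_inv1 x : -1 < x ->
  is_derive x (1 : R) (fun s => (1 + s)^-1) (- (1 + x)^-1 ^+ 2).
Proof.
move=> x1; have h : 1 + x != 0 by rewrite gt_eqF //; lra.
apply: (is_derive_eq (@is_deriveV R (fun s => 1 + s) x 1 1 h (is_derive_addcl 1 (is_derive_id x 1)))).
by rewrite /GRing.scale /= mulr1 -exprVn.
Qed.

Lemma derive_ge0_le f f' a b : a <= b ->
  (forall x, a <= x <= b -> is_derive x (1 : R) f (f' x)) ->
  (forall x, a < x < b -> 0 <= f' x) -> f a <= f b.
Proof.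
rewrite le_eqVlt => /predU1P[->//|ab] df f'0.
have h x : x \in `]a, b[ -> a <= x <= b.
  by rewrite in_itv /= => /andP[/ltW -> /ltW ->].
have cf : {within `[a, b], continuous f}.
  apply: derivable_within_continuous => x; rewrite in_itv /= => xab.
  by have [] := df _ xab.
have [c cab fE] := @MVT R f f' a b ab (fun x hx => df x (h x hx)) cf.
rewrite -subr_ge0 fE mulr_ge0 ?subr_ge0 ?(ltW ab)//.
by apply: f'0; move: cab; rewrite in_itv.
Qed.

(** At the infimum of the points where positivity fails, the second premise gives positivity, and
    continuity carries it further, against the choice of the infimum. At [s = 0] the inner condition
    is empty, so the premise includes initial positivity. *)
Lemma positive_continuation f b :
  (forall s, 0 <= s <= b -> {for s, continuous f}) ->
  (forall s, 0 <= s <= b -> (forall r, 0 <= r < s -> 0 < f r) -> 0 < f s) ->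
  forall s, 0 <= s <= b -> 0 < f s.
Proof.
move=> cf hf s sb; apply/negP => /negP fs.
pose B : set R := [set r | 0 <= r <= b /\ ~~ (0 < f r)].
have Bs : B s by [].
have lbB : has_lbound B by exists 0 => r [/andP[]].
have hiB : has_inf B by split => //; exists s.
set s0 := inf B.
have s00 : 0 <= s0 by apply: lb_le_inf; [exists s|move=> r [/andP[]]].
have s0s : s0 <= s by exact: ge_inf.
have s0b : 0 <= s0 <= b by rewrite s00 (le_trans s0s)//; case/andP: sb.
have fs0 : 0 < f s0.
  apply: hf => // r /andP[r0 rs0]; apply/negP => /negP fr.
  have : B r by split => //; rewrite r0 ltW// (lt_le_trans rs0)//; case/andP: s0b.
  by move=> /(ge_inf lbB); rewrite -/s0 leNgt rs0.
have /cvgrPdist_lt/(_ _ fs0) := cf _ s0b.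
rewrite -filter_from_ballE => -[d /= d0 hd].
have [r Br rd] := inf_adherent d0 hiB.
have := hd r; rewrite /ball /= -/s0 => h.
have s0r : s0 <= r by exact: ge_inf.
have : `|f s0 - f r| < f s0.
  by apply: h; rewrite distrC ger0_norm ?subr_ge0// ltrBlDl.
have [_] := Br; rewrite -leNgt => fr.
rewrite ger0_norm; lra.
Qed.

Lemma ler_powR_anti (p x y : R) : 1 < p -> 0 < x -> x <= y -> y `^ (1 - p) <= x `^ (1 - p).
Proof.
move=> p1 x0 xy; have y0 := lt_le_trans x0 xy.
rewrite -(opprB p 1) !powRN lef_pV2 ?posrE ?powR_gt0//.
by rewrite ge0_ler_powR ?nnegrE ?subr_ge0 ?(ltW p1) ?(ltW x0) ?(ltW y0).
Qed.

End real_calculus.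

Section blowup_ode.
Variable R : realType.
Variables (mu q lam p kn c0 b : R) (F G G' : R -> R).
Hypotheses (mu0 : 0 <= mu) (q0 : 0 <= q) (lam0 : 0 < lam)
  (lamE : lam ^+ 2 = q + 2 + mu) (p1 : 1 < p) (c00 : 0 < c0).
Let r (s : R) : R := (1 + s)^-1.
Let c (s : R) : R := c0 * expR (- (p - 1) * (lam * s) - kn * ln (1 + s)).
Hypotheses (dF : forall s : R, 0 <= s <= b -> is_derive s (1 : R) F (G s))
  (dG : forall s : R, 0 <= s <= b -> is_derive s (1 : R) G (G' s))
  (hG : forall s : R, 0 <= s <= b ->
     - (mu * r s) * G s + (lam ^+ 2 - q * r s ^+ 2) * F s
       + c s * Num.max (G s) 0 `^ p <= G' s)
  (F0 : 0 <= F 0) (G0 : 0 <= G 0).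

Let r_itv (s : R) : 0 <= s -> 0 < r s <= 1.
Proof. by move=> s0; rewrite /r invr_gt0 invf_le1 ?lerDl//; lra. Qed.

Let c_ge0 s : 0 <= c s.
Proof. by rewrite mulr_ge0// ?expR_ge0// ltW. Qed.

Let mass_ge0 (s : R) : 0 <= s -> 0 <= lam ^+ 2 - q * r s ^+ 2.
Proof.
move=> /r_itv /andP[r0 r1]; have : r s ^+ 2 <= 1 by rewrite expr_le1// ltW.
rewrite lamE => r2; have : q * r s ^+ 2 <= q by rewrite ler_piMr.
move: (q * _) mu0 => X m0 Xq; lra.
Qed.

(** One formula for the three integrating factors of this section: [a] is the exponential rate, [k]
    the power of [1 + s], [l] a bounded correction. *)
Let dweight (a k l s : R) : 0 <= s ->
  is_derive s (1 : R) (fun s => expR (a * s + (k * ln (1 + s) + l * r s)))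
   (expR (a * s + (k * ln (1 + s) + l * r s)) * (a + k * r s - l * r s ^+ 2)).
Proof.
move=> s0; have s1 : -1 < s by lra.
apply: (is_derive_eq (is_derive_expR_comp (is_derive_add
  (is_derive_mulc a (is_derive_id s 1)) (is_derive_add
  (is_derive_mulc k (is_derive_ln1 s1)) (is_derive_mulc l (is_derive_inv1 s1)))))).
by rewrite mulr1 /r; ring.
Qed.

(** [F] may vanish at 0, while continuation needs strict positivity. The perturbation is harmless
    because all terms that it adds to the differential inequality, from damping, mass and second
    derivative, are nonnegative. *)
Let F_perturbed_gt0 (e : R) : 0 < e ->
  forall s : R, 0 <= s <= b -> 0 < F s + e * expR (lam * s).
Proof.
move=> e0; pose E s := F s + e * expR (lam * s).
pose H s := G s + e * lam * expR (lam * s).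
have dexp s : is_derive s (1 : R) (fun s => expR (lam * s)) (lam * expR (lam * s)).
  apply: (is_derive_eq (is_derive_expR_comp (is_derive_mulc lam (is_derive_id s 1)))).
  by rewrite mulr1 mulrC.
have dE (s : R) : 0 <= s <= b -> is_derive s (1 : R) E (H s).
  move=> sb; apply: (is_derive_eq (is_derive_add (dF sb) (is_derive_mulc e (dexp s)))).
  by rewrite mulrA.
(* [W] is [(1 + s) ^ mu], the integrating factor of the damping: as long as [E] is positive, [W * H]
   does not decrease, so [H] is nonnegative and [E] stays above [E 0]. *)
pose W s := expR (0 * s + (mu * ln (1 + s) + 0 * r s)).
pose dWH s := W s * (mu * r s * H s + (G' s + e * lam ^+ 2 * expR (lam * s))).
have dH (s : R) : 0 <= s <= b -> is_derive s (1 : R) (fun s => W s * H s) (dWH s).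
  move=> sb; have [s0 _] := andP sb.
  apply: (is_derive_eq (is_derive_mul (dweight 0 mu 0 s0)
    (is_derive_add (dG sb) (is_derive_mulc (e * lam) (dexp s))))).
  by rewrite /dWH /W /H; ring.
have E0 : 0 < E 0 by rewrite /E mulr0 expR0 mulr1 ltr_wpDl.
apply: (@positive_continuation _ E b) => s sb.
  apply: differentiable_continuous; apply/derivable1_diffP.
  by have [] := dE _ sb.
move=> hE; have [s0 sb'] := andP sb.
rewrite -/(E s); move: s0; rewrite le_eqVlt => /predU1P[<-//|s0].
have inb (x : R) : 0 <= x <= s -> 0 <= x <= b.
  by move=> /andP[-> /le_trans]; apply.
have Ele x : 0 <= x <= s -> 0 <= x -> x < s -> 0 < E x.
  by move=> _ x0 xs; apply: hE; rewrite x0 xs.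
have WH (x : R) : 0 <= x <= s -> 0 <= W x * H x.
  move=> /andP[x0 xs]; apply: (@le_trans _ _ (W 0 * H 0)).
    rewrite mulr_ge0 ?expR_ge0// /H mulr0 expR0 mulr1 addr_ge0// mulr_ge0// ltW//.
  apply: (@derive_ge0_le _ (fun y => W y * H y) dWH _ _ x0) => [y /andP[y0 yx]|y /andP[y0 yx]].
    by apply: dH; rewrite y0 (le_trans yx)// (le_trans _ sb')// ltW.
  have ys : y < s by exact: lt_le_trans xs.
  have yb : 0 <= y <= b by rewrite ltW//= (le_trans _ sb')// ltW.
  rewrite /dWH mulr_ge0 ?expR_ge0//.
  have := hG yb; have := hE y; rewrite (ltW y0) ys => /(_ isT).
  have : 0 <= c y * Num.max (G y) 0 `^ p by rewrite mulr_ge0// powR_ge0.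
  have := mass_ge0 (ltW y0); have /andP[r0 _] := r_itv (ltW y0).
  rewrite /E /H; have := expR_gt0 (lam * y).
  move: (expR _) (c y * _) => X C X0 m0 C0 E0' hg.
  have h1 : 0 <= (lam ^+ 2 - q * r y ^+ 2) * (F y + e * X) by rewrite mulr_ge0// ltW.
  have h2 : 0 <= mu * r y * (e * lam * X) by rewrite !mulr_ge0// ltW.
  have h3 : 0 <= q * r y ^+ 2 * (e * X) by rewrite !mulr_ge0// ?ltW// exprn_ge0// ltW.
  lra.
apply: (lt_le_trans E0); apply: (@derive_ge0_le _ E H _ _ (ltW s0)) => [x /inb /dE//|x].
move=> /andP[/ltW x0 /ltW xs].
by have := WH x; rewrite x0 xs => /(_ isT); rewrite pmulr_rge0 ?expR_gt0.
Qed.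

Let F_ge0 (s : R) : 0 <= s <= b -> 0 <= F s.
Proof.
move=> sb; apply/ler_addgt0Pl => e e0.
have X0 : 0 < expR (lam * s) by exact: expR_gt0.
have := F_perturbed_gt0 (divr_gt0 e0 X0) sb.
by rewrite divfK ?gt_eqF// addrC => /ltW.
Qed.

(* [w = G - s / (1 + s) F] is a supersolution of a linear first-order equation. *)
Let F_le_G (s : R) : 0 <= s <= b -> (1 - r s) * F s <= G s.
Proof.
move=> sb; have [s0 s1] := andP sb.
pose w s := G s + (- 1 + r s) * F s.
(* This weight removes [G] from the derivative: its rate [1 + (mu - 1) * r] cancels [- mu * r], from
   the equation, and [- 1 + r], from differentiating [w]. *)
pose W s := expR (1 * s + ((mu - 1) * ln (1 + s) + 0 * r s)).
suff : W 0 * w 0 <= W s * w s.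
  have : 0 <= W 0 * w 0.
    by rewrite mulr_ge0 ?expR_ge0// /w /r addr0 invr1 addNr mul0r addr0.
  move=> /le_trans /[apply]; rewrite pmulr_rge0 ?expR_gt0// /w; lra.
have dr (x : R) : 0 <= x -> is_derive x (1 : R) (fun s => - 1 + r s) (- r x ^+ 2).
  move=> x0; have x1 : -1 < x by lra.
  exact: (is_derive_addcl (-1) (is_derive_inv1 x1)).
have inb (x : R) : 0 <= x <= s -> 0 <= x <= b by move=> /andP[-> /le_trans]; apply.
apply: (@derive_ge0_le _ (fun s => W s * w s) (fun x => W x * (1 + (mu - 1) * r x - 0 * r x ^+ 2) * w x
   + W x * (G' x + (- r x ^+ 2 * F x + (- 1 + r x) * G x))) _ _ s0) => [x xs|x /andP[x0 xs]].
  have [x0 _] := andP xs; exact: (is_derive_mul (dweight 1 (mu - 1) 0 x0)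
    (is_derive_add (dG (inb _ xs)) (is_derive_mul (dr _ x0) (dF (inb _ xs))))).
have xb : 0 <= x <= b by apply: inb; rewrite !ltW.
rewrite -mulrA -mulrDr mulr_ge0 ?expR_ge0//.
have := hG xb; have Fx := F_ge0 xb; have /andP[r0 r1] := r_itv (ltW x0).
have : 0 <= c x * Num.max (G x) 0 `^ p by rewrite mulr_ge0// powR_ge0.
rewrite /w; move: (c x * _) => C C0 hg.
(* Only a multiple of [F] is left. Its coefficient is nonnegative because
   [r ^+ 2 + (1 - r) ^+ 2 <= 1], [mu * r * (1 - r) <= mu] and [q * r ^+ 2 <= q], against
   [lam ^+ 2 = q + 2 + mu]. *)
have : 0 <= (lam ^+ 2 - q * r x ^+ 2 - r x ^+ 2
  - (mu * r x + 1 - r x) * (1 - r x)) * F x.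
  rewrite mulr_ge0// lamE.
  have r2 : r x ^+ 2 <= 1 by rewrite expr_le1// ltW.
  have : q * r x ^+ 2 <= q by rewrite ler_piMr.
  have : mu * r x <= mu by rewrite ler_piMr.
  have : 0 <= mu * r x * r x by rewrite !mulr_ge0// ltW.
  nra.
lra.
Qed.

Let G_ge0 (s : R) : 0 <= s <= b -> 0 <= G s.
Proof.
move=> sb; apply: le_trans (F_le_G sb).
have /andP[s0 _] := sb; have /andP[_ r1] := r_itv s0.
by rewrite mulr_ge0 ?F_ge0// subr_ge0.
Qed.

(** With [d] for the time derivative, the linear operator is [(d - lam + mu / 2 * r) (d + lam + mu /
    2 * r)] up to an error of order [r ^+ 2], and [v] is the inner factor applied to [F]. The error
    moves [(mu * (mu - 2) / 4 - q) * r ^+ 2 * F] into the equation of [v]. For [q = nu ^+ 2] this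
    coefficient is [(delta - 1) / 4], and only its absolute value enters. The division by [lam]
    matches [v >= lam * F]. *)
Let k : R := `|mu * (mu - 2) / 4 - q| / lam.
Let k_ge0 : 0 <= k. Proof. by rewrite divr_ge0// ltW. Qed.
Let v (s : R) := G s + (lam + mu / 2 * r s) * F s.
(* The summand [- k * r s] of the exponent absorbs the errors of order [r s ^+ 2]. *)
Let W (s : R) := expR (- lam * s + (mu / 2 * ln (1 + s) + (- k) * r s)).
Let z (s : R) := W s * v s.
Let f (s : R) := W s * (c s * G s `^ p).

Let z' (s : R) := W s * (- lam + mu / 2 * r s - - k * r s ^+ 2) * v s
  + W s * (G' s + (mu / 2 * - r s ^+ 2 * F s + (lam + mu / 2 * r s) * G s)).

Let dz (s : R) : 0 <= s <= b -> is_derive s (1 : R) z (z' s) /\ f s <= z' s.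
Proof.
move=> sb; have [s0 _] := andP sb; have s1 : -1 < s by lra.
have dr : is_derive s (1 : R) (fun s => lam + mu / 2 * r s) (mu / 2 * - r s ^+ 2).
  exact: (is_derive_addcl lam (is_derive_mulc (mu / 2) (is_derive_inv1 s1))).
split.
  exact: (is_derive_mul (dweight (- lam) (mu / 2) (- k) s0)
    (is_derive_add (dG sb) (is_derive_mul dr (dF sb)))).
rewrite /f /z' /v -mulrA -mulrDr ler_wpM2l ?expR_ge0//.
have := hG sb; rewrite (max_idPl (G_ge0 sb)).
have := F_ge0 sb; have := G_ge0 sb; have /andP[r0 r1] := r_itv s0.
move: (c s * _) => C G_0 F_0 hg.
have : 0 <= k * r s ^+ 2 * (G s + mu / 2 * r s * F s).
  apply: mulr_ge0; first by rewrite mulr_ge0// exprn_ge0// ltW.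
  apply: addr_ge0 => //; apply: mulr_ge0 => //; apply: mulr_ge0; last exact: ltW.
  by rewrite divr_ge0.
(* [k * lam] is the absolute value of the other coefficient, so the sum is nonnegative whatever that
   coefficient's sign. *)
have : 0 <= k * r s ^+ 2 * (lam * F s) + (mu * (mu - 2) / 4 - q) * r s ^+ 2 * F s.
  rewrite (_ : _ + _ = (k * lam + (mu * (mu - 2) / 4 - q)) * (r s ^+ 2 * F s)); last by ring.
  rewrite mulr_ge0//; last by rewrite mulr_ge0// exprn_ge0// ltW.
  by rewrite /k divfK ?gt_eqF// -lerBlDr sub0r ler_normr lexx orbT.
lra.
Qed.

Let lam1 : 1 <= lam.
Proof.
rewrite -(@expr_ge1 _ 2)// ?ltW// lamE; move: mu0 q0 => ? ?; lra.
Qed.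

Hypothesis FG0 : 0 < F 0 + G 0.

Let z0_ge : expR (- k) * (F 0 + G 0) <= z 0.
Proof.
rewrite /z /W /r addr0 ln1 invr1 !mulr1 !mulr0 !add0r ler_wpM2l ?expR_ge0//.
rewrite /v /r addr0 invr1 mulr1.
have : 0 <= mu / 2 * F 0 by rewrite mulr_ge0 ?divr_ge0.
have : F 0 <= lam * F 0 by rewrite ler_peMl.
move=> *; lra.
Qed.

Let z_homo (s t : R) : 0 <= s -> s <= t -> t <= b -> z s <= z t.
Proof.
move=> s0 st tb; have inb (x : R) : s <= x <= t -> 0 <= x <= b.
  by move=> /andP[/(le_trans s0) -> /le_trans]; apply.
apply: (@derive_ge0_le _ z z' _ _ st) => [x /inb /dz[]//|x /andP[/ltW sx /ltW xt]].
have [|_] := @dz x; first by apply: inb; rewrite sx.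
by apply: le_trans; rewrite mulr_ge0 ?expR_ge0// mulr_ge0 ?powR_ge0.
Qed.

Let z_gt0 (s : R) : 0 <= s <= b -> 0 < z s.
Proof.
move=> /andP[s0 sb]; apply: lt_le_trans (z_homo (lexx 0) s0 sb).
by apply: lt_le_trans z0_ge; rewrite mulr_gt0 ?expR_gt0.
Qed.

(** Origin of the constant: for [s >= 1], [F <= 2 * G] and [r <= 1] give [v <= G + (lam + mu / 2) *
    (2 * G) = A * G]. *)
Let A := 1 + 2 * lam + mu.
Let theta := kn + (p - 1) * (mu / 2).

Let A_gt0 : 0 < A.
Proof. by rewrite /A; move: lam0 mu0 => ? ?; lra. Qed.

(** The start at [s = 1] keeps [1 - r s >= 1 / 2], so that [F <= 2 * G]. In the comparison of
    exponents the terms in [lam * s] cancel, the powers of [1 + s] differ by exactly [theta], and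
    the correction leaves [(p - 1) * k * r s >= 0] to spare. *)
Let f_ge (s : R) : 1 <= s <= b ->
  c0 / A `^ p * expR (- theta * ln (1 + s)) * z s `^ p <= f s.
Proof.
move=> /andP[s1 sb]; have s0 : 0 <= s by lra.
have s0b : 0 <= s <= b by rewrite s0.
have /andP[r0 _] := r_itv s0.
have r2 : r s <= 2^-1 by rewrite /r lef_pV2 ?posrE; lra.
have Gs := G_ge0 s0b; have Fs := F_ge0 s0b.
have FG : F s <= 2 * G s.
  have : 2^-1 * F s <= (1 - r s) * F s by rewrite ler_wpM2r//; lra.
  by have := F_le_G s0b; lra.
have vA : v s <= A * G s.
  rewrite /v /A.
  have : (lam + mu / 2 * r s) * F s <= (lam + mu / 2) * (2 * G s).
    rewrite ler_pM ?addr_ge0 ?mulr_ge0 ?divr_ge0 ?(ltW lam0) ?(ltW r0)//.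
    by rewrite lerD2l ler_piMr ?divr_ge0//; lra.
  move: (_ * F s) => X; lra.
have zA : z s `^ p <= (W s * (A * G s)) `^ p.
  rewrite ge0_ler_powR ?nnegrE ?(ltW (z_gt0 s0b)) ?mulr_ge0 ?expR_ge0 ?(ltW A_gt0)//.
    by move: p1 => ?; lra.
  by rewrite ler_wpM2l ?expR_ge0.
have c1_ge0 : 0 <= c0 / A `^ p * expR (- theta * ln (1 + s)).
  by rewrite mulr_ge0 ?expR_ge0// divr_ge0 ?powR_ge0// ltW.
apply: (le_trans (ler_wpM2l c1_ge0 zA)).
rewrite !powRM ?mulr_ge0 ?expR_ge0 ?(ltW A_gt0)//.
rewrite [X in X <= _](_ : _ = (expR (- theta * ln (1 + s)) * W s `^ p) * (c0 * G s `^ p)); last first.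
  have : A `^ p != 0 by rewrite gt_eqF ?powR_gt0.
  by move=> ?; field.
rewrite /f /c (_ : W s * _ = W s * expR (- (p - 1) * (lam * s) - kn * ln (1 + s)) * (c0 * G s `^ p)); last by ring.
rewrite ler_wpM2r ?mulr_ge0 ?powR_ge0 ?(ltW c00)// -expRM -!expRD ler_expR.
rewrite /theta -subr_ge0.
have p10 : 0 <= p - 1 by rewrite subr_ge0 ltW.
have := mulr_ge0 (mulr_ge0 p10 k_ge0) (ltW r0).
move: (r s) (ln _) => rr l; lra.
Qed.

Variables (P : R -> R).
Hypothesis dP : forall s : R, 1 <= s <= b ->
  is_derive s (1 : R) P (expR (- theta * ln (1 + s))).

(** [P] is an arbitrary primitive, so that the power and the logarithm, the subcritical and the
    critical case, come from the same estimate. The monotone quantity is [Y], from integrating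
    [z ^ (- p) * z']. *)
Lemma ode_blowup : 1 <= b ->
  (p - 1) * (c0 / A `^ p) * (P b - P 1) <= (expR (- k) * (F 0 + G 0)) `^ (1 - p).
Proof.
move=> b1; have b0 : 0 <= b by lra.
pose c1 := c0 / A `^ p; pose e (s : R) := expR (- theta * ln (1 + s)).
have hD (x : R) : 1 <= x <= b -> is_derive x (1 : R) z (z' x) /\ f x <= z' x.
  by move=> /andP[x1 xb]; apply: dz; rewrite xb andbT; lra.
pose Y (s : R) := - (z s `^ (1 - p)) + - ((p - 1) * c1) * P s.
pose Y' (s : R) := - 1 * ((1 - p) * z s `^ (1 - p - 1) * z' s) + - ((p - 1) * c1) * e s.
have zpos (x : R) : 1 <= x <= b -> 0 < z x.
  by move=> /andP[x1 xb]; apply: z_gt0; rewrite xb andbT; lra.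
have : Y 1 <= Y b.
  apply: (@derive_ge0_le _ Y Y' _ _ b1) => [x xb|x /andP[/ltW x1 /ltW xb]].
    have [hz _] := hD _ xb; have zx := zpos _ xb.
    apply: is_derive_add; last exact: (is_derive_mulc _ (dP xb)).
    rewrite (_ : (fun s => _) = (fun s => -1 * z s `^ (1 - p))); last first.
      by apply/funext => s; rewrite mulN1r.
    exact: (is_derive_mulc (-1) (is_derive1_comp (is_derive1_powR (1 - p) zx) hz)).
  have xb' : 1 <= x <= b by rewrite x1.
  have [_ fD] := hD _ xb'; have zx := zpos _ xb'.
  rewrite /Y' (_ : _ + _ = (p - 1) * (z x `^ (1 - p - 1) * z' x - c1 * e x)); last by ring.
  rewrite mulr_ge0// ?subr_ge0 ?(ltW p1)//.
  apply: (le_trans _ (ler_wpM2l (powR_ge0 _ _) (le_trans (f_ge xb') fD))).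
  rewrite -/c1 -/(e x) mulrCA -powRD; last by rewrite (gt_eqF zx) implybT.
  by rewrite (_ : 1 - p - 1 + p = 0) ?powRr0 ?mulr1//; ring.
rewrite /Y => hY.
(* The integration starts at 1 but the data live at 0; [z] is nondecreasing on the whole interval
   and [1 - p < 0]. *)
have : z 1 `^ (1 - p) <= (expR (- k) * (F 0 + G 0)) `^ (1 - p).
  apply: ler_powR_anti => //; first by rewrite mulr_gt0 ?expR_gt0.
  by apply: le_trans z0_ge _; apply: z_homo.
have := powR_ge0 (z b) (1 - p).
rewrite -/c1; move: hY; lra.
Qed.

End blowup_ode.

(** * Blow-up from an integral inequality *)

Section integral_blowup.
Variable R : realType.
Local Notation leb1 := (@lebesgue_measure R).

Lemma is_derive_continuous (f : R -> R) (x df : R) : is_derive x (1 : R) f df ->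
  {for x, continuous f}.
Proof.
by move=> [hf _]; apply: differentiable_continuous; apply/derivable1_diffP.
Qed.

Lemma continuous_normr_powR (p : R) : 1 < p -> continuous (fun x : R => `|x| `^ p).
Proof.
move=> p1 x; have [->|x0] := eqVneq x 0.
  apply/cvgrPdist_lt => e e0; rewrite normr0 powR0; last by rewrite gt_eqF//; lra.
  apply/nbhs_ballP; exists (Num.min e 1); first by rewrite /= lt_min e0 /=; lra.
  move=> y; rewrite /ball /= !sub0r !normrN (ger0_norm (powR_ge0 _ _)) lt_min.
  move=> /andP[ye y1].
  have [->|y0] := eqVneq y 0; first by rewrite normr0 powR0// gt_eqF//; lra.
  by apply: le_lt_trans ye; rewrite ge1r_powR ?normr_gt0 ?y0 ?ltW.
apply: (@continuous_comp _ _ _ (@Num.norm _ R) (fun y => y `^ p)); first exact: norm_continuous.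
have nx : 0 < `|x| by rewrite normr_gt0.
exact: (is_derive_continuous (is_derive1_powR p nx)).
Qed.

Lemma continuous_primitive (f : R -> R) : continuous f ->
  exists H : R -> R, [/\ H 0 = 0,
    forall x : R, 0 <= x -> is_derive x (1 : R) H (f x) &
    forall x : R, 0 <= x -> H x = \int[leb1]_(t in `[0, x]) f t].
Proof.
move=> cf.
have itf (a b : R) : leb1.-integrable `[a, b] (EFin \o f).
  apply: continuous_compact_integrable; first exact: segment_compact.
  exact: continuous_subspaceT.
(* The integral starts at -1 so that 0 is interior and the derivative at 0 is two-sided. *)
pose I (x : R) := \int[leb1]_(t in `[-1, x]) f t.
exists (fun x => - I 0 + I x); split=> [|x x0|x x0]; first by rewrite addNr.
  have [d1 d2] := @continuous_FTC1_closed R f (-1) x (x + 1) (ltac:(lra)) (itf _ _) (ltac:(lra)) (cf x).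
  apply: is_derive_addcl.
  by apply: DeriveDef; [exact: d1|rewrite -derive1E; exact: d2].
rewrite addrC (Rintegral_itvB (itf _ _)) ?bnd_simp ?lerN10//.
rewrite Rintegral_itv_obnd_cbnd//; apply: integrableS (itf 0 x) => //.
by apply: subset_itvr; rewrite bnd_simp.
Qed.

(** A variant of [derive_ge0_le] that asks for no derivative at the endpoints: [F] is known to be
    differentiable only at interior times. *)
Lemma derive_ge0_le_oo (f f' : R -> R) (a b : R) : a <= b ->
  {within `[a, b], continuous f} ->
  (forall x : R, a < x < b -> is_derive x (1 : R) f (f' x)) ->
  (forall x : R, a < x < b -> 0 <= f' x) -> f a <= f b.
Proof.
rewrite le_eqVlt => /predU1P[->//|ab] cf df f'0.
have h (x : R) : x \in `]a, b[ -> a < x < b by rewrite in_itv.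
have [c cab fE] := @MVT R f f' a b ab (fun x hx => df x (h x hx)) cf.
by rewrite -subr_ge0 fE mulr_ge0 ?subr_ge0 ?(ltW ab)// f'0// h.
Qed.

Variables (mu q lam p kn c0 b : R) (F G : R -> R).
Hypotheses (mu0 : 0 <= mu) (q0 : 0 <= q) (lam0 : 0 < lam)
  (lamE : lam ^+ 2 = q + 2 + mu) (p1 : 1 < p) (c00 : 0 < c0).
Let r (s : R) : R := (1 + s)^-1.
Let c (s : R) : R := c0 * expR (- (p - 1) * (lam * s) - kn * ln (1 + s)).
Let g (s : R) := expR (mu * s) *
  ((mu - mu * r s) * G s + (lam ^+ 2 - q * r s ^+ 2) * F s + c s * `|G s| `^ p).
Hypotheses
  (cF : {within `[0, b], continuous F}) (cG : {within `[0, b], continuous G})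
  (dF : forall s : R, 0 < s < b -> is_derive s (1 : R) F (G s))
  (hG : forall t : R, 0 <= t <= b ->
    G 0 + \int[leb1]_(s in `[0, t]) g s <= expR (mu * t) * G t)
  (F0 : 0 <= F 0) (G0 : 0 <= G 0) (FG0 : 0 < F 0 + G 0).
Variables (P : R -> R).
Hypothesis dP : forall s : R, 1 <= s <= b ->
  is_derive s (1 : R) P (expR (- (kn + (p - 1) * (mu / 2)) * ln (1 + s))).

(** Extends a function continuous on [[0, b]] to a function continuous on the line, as required by
    [continuous_primitive]. *)
Let clamp (s : R) := Num.max 0 (Num.min s b).

Let clampE (s : R) : 0 <= s <= b -> clamp s = s.
Proof. by move=> /andP[s0 sb]; rewrite /clamp (min_idPl sb) (max_idPr s0). Qed.

Let clamp_itv (s : R) : 0 <= b -> 0 <= clamp s <= b.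
Proof.
by move=> b0; rewrite /clamp le_max lexx ge_max b0 ge_min lexx orbT.
Qed.

Let continuous_clamp (f : R -> R) : 0 <= b ->
  {within `[0, b], continuous f} -> continuous (f \o clamp).
Proof.
move=> b0 /subspace_continuousP cf x.
have xb : `[0, b]%classic (clamp x) by rewrite /= in_itv /=; exact: clamp_itv.
apply: (cvg_comp _ _ _ (cf _ xb)).
move=> A hA; have cc : {for x, continuous clamp}.
  apply: (@continuous_max R R (cst 0)); first exact: cst_continuous.
  by apply: (@continuous_min R R id (cst b)); [|exact: cst_continuous].
have h : nbhs x (clamp @^-1` [set t | `[0, b]%classic t -> A t]) by exact: (cc _ hA).
suff : nbhs x (clamp @^-1` A) by [].
apply: filterS h => y; apply.
by rewrite /= in_itv /=; exact: clamp_itv.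
Qed.

Lemma integral_blowup : 1 <= b ->
  (p - 1) * (c0 / (1 + 2 * lam + mu) `^ p) * (P b - P 1) <=
  (expR (- (`|mu * (mu - 2) / 4 - q| / lam)) * (F 0 + G 0)) `^ (1 - p).
Proof.
move=> b1; have b0 : 0 <= b by lra.
have cln (s : R) : 0 <= s -> {for s, continuous (fun s : R => ln (1 + s))}.
  by move=> s0; apply: is_derive_continuous (is_derive_ln1 _); lra.
have cr (s : R) : 0 <= s -> {for s, continuous r}.
  by move=> s0; apply: is_derive_continuous (is_derive_inv1 _); lra.
have cexp (a k : R) (e : R -> R) (s : R) : 0 <= s ->
    (forall t, e t = a * t - k * ln (1 + t)) ->
    {for s, continuous (fun t : R => expR (e t))}.
  move=> s0 /funext ->; apply: (@continuous_comp _ _ _ (fun s => a * s - k * ln (1 + s)) expR).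
    apply: cvgB; apply: cvgM; [exact: cvg_cst|exact: cvg_id|exact: cvg_cst|exact: cln].
  exact: continuous_expR.
have cg : {within `[0, b], continuous g}.
  apply/subspace_continuousP => s sb.
  have s0 : 0 <= s by move: sb; rewrite /= in_itv /= => /andP[].
  have win (f : R -> R) : {for s, continuous f} ->
    f x @[x --> within `[0, b] (nbhs s)] --> f s by exact: cvg_within_filter.
  have /subspace_continuousP cF' := cF; have /subspace_continuousP cG' := cG.
  apply: cvgM; last apply: cvgD; first 2 last.
  - apply: cvgM.
      apply: (win c); apply: cvgM; first exact: cvg_cst.
      by apply: (cexp (- (p - 1) * lam) kn _ s s0) => t; rewrite mulrA.
    have := continuous_normr_powR p1 (x := G s).
    move=> h; apply: (@continuous_cvg _ _ _ _ _ G (fun y : R => `|y| `^ p) _ h).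
    exact: cG'.
  - apply: (win (fun s => expR (mu * s))).
    by apply: (cexp mu 0 _ s s0) => t; rewrite mul0r subr0.
  - apply: cvgD; apply: cvgM; [|exact: cG'| |exact: cF'].
      apply: (win (fun s => mu - mu * r s)).
      by apply: cvgB; [|apply: cvgM; [|exact: cr]]; exact: cvg_cst.
    apply: (win (fun s => lam ^+ 2 - q * r s ^+ 2)).
    apply: cvgB; [|apply: cvgM]; [exact: cvg_cst..|].
    by rewrite (_ : (fun s => _) = r \* r)//; apply: cvgM; exact: cr.
have [H [H0 dH HE]] := continuous_primitive (continuous_clamp b0 cg).
(* [G] need not be differentiable: the integral inequality gives [C^1] minorants
   [Gl] and [Fl] of [G] and [F] that satisfy the same differential inequality,
   because its right-hand side is nondecreasing in [F] and, up to [- mu * G], in [G]. *)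
pose Gl (t : R) := expR (- mu * t) * (G 0 + H t).
pose Gl' (t : R) := expR (- mu * t) * - mu * (G 0 + H t) + expR (- mu * t) * g (clamp t).
have dGl (t : R) : 0 <= t -> is_derive t (1 : R) Gl (Gl' t).
  move=> t0; apply: is_derive_mul; last exact: (is_derive_addcl _ (dH _ t0)).
  apply: (is_derive_eq (is_derive_expR_comp (is_derive_mulc (- mu) (is_derive_id t 1)))).
  by rewrite mulr1.
have GlG (t : R) : 0 <= t <= b -> Gl t <= G t.
  move=> tb; have [t0 tb'] := andP tb.
  rewrite /Gl mulNr expRN ler_pdivrMl ?expR_gt0// (HE _ t0).
  have -> : \int[leb1]_(x in `[0, t]) (g \o clamp) x = \int[leb1]_(x in `[0, t]) g x; last exact: hG.
  apply: eq_Rintegral => x; rewrite inE /= in_itv /= => /andP[x0 xt].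
  by rewrite /= clampE// x0 (le_trans xt).
have cGl : {within `[0, b], continuous Gl}.
  apply/subspace_continuousP => s; rewrite /= in_itv /= => /andP[s0 sb].
  apply: cvg_within_filter; exact: (is_derive_continuous (dGl s s0)).
have [K [K0 dK KE]] := continuous_primitive (continuous_clamp b0 cGl).
pose Fl (t : R) := F 0 + K t.
have dFl (t : R) : 0 <= t <= b -> is_derive t (1 : R) Fl (Gl t).
  move=> tb; have [t0 _] := andP tb; apply: is_derive_addcl.
  by have := dK _ t0; rewrite /comp clampE.
have FlF (t : R) : 0 <= t <= b -> Fl t <= F t.
  move=> tb; have [t0 tb'] := andP tb.
  have inb (x : R) : 0 <= x <= t -> 0 <= x <= b.
    by move=> /andP[-> /le_trans]; apply.
  suff : F 0 + -1 * Fl 0 <= F t + -1 * Fl t by rewrite {1}/Fl K0; lra.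
  apply: (@derive_ge0_le_oo (fun t => F t + -1 * Fl t) (fun t => G t + -1 * Gl t) _ _ t0).
  - apply/subspace_continuousP => s; rewrite /= in_itv /= => st.
    have /andP[s0 sb] := inb _ st.
    apply: cvgD.
      have /subspace_continuousP cF' : {within `[0, t], continuous F}.
        by apply: continuous_subspaceW cF => x /=; rewrite !in_itv /=; exact: inb.
      by apply: cF'; rewrite /= in_itv.
    apply: cvg_within_filter; apply: cvgM; first exact: cvg_cst.
    by apply: (is_derive_continuous (dFl s _)); rewrite s0.
  - move=> x /andP[x0 xt]; apply: is_derive_add.
      by apply: dF; rewrite x0 (lt_le_trans xt).
    by apply: is_derive_mulc; apply: dFl; apply: inb; rewrite !ltW.
  - move=> x /andP[x0 xt]; have : Gl x <= G x by apply: GlG; apply: inb; rewrite !ltW.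
    by lra.
have Gl0 : Gl 0 = G 0 by rewrite /Gl mulr0 expR0 mul1r H0 addr0.
have Fl0 : Fl 0 = F 0 by rewrite /Fl K0 addr0.
have := @ode_blowup R mu q lam p kn c0 b Fl Gl Gl' mu0 q0 lam0 lamE p1 c00 dFl.
rewrite Gl0 Fl0; apply => // s sb; have [s0 _] := andP sb; first exact: dGl.
have r01 : 0 < r s <= 1.
  by rewrite /r invr_gt0 invf_le1 ?lerDl//; lra.
have [r0 r1] := andP r01.
have e1 : expR (- mu * s) * expR (mu * s) = 1.
  by rewrite -expRD -mulrDl addNr mul0r expR0.
have -> : Gl' s = - mu * Gl s + expR (- mu * s) * expR (mu * s) *
    ((mu - mu * r s) * G s + (lam ^+ 2 - q * r s ^+ 2) * F s + c s * `|G s| `^ p).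
  by rewrite /Gl' /Gl /g clampE//; ring.
rewrite e1 mul1r -/(r s) -/(c s).
have h1 : (mu - mu * r s) * Gl s <= (mu - mu * r s) * G s.
  by rewrite ler_wpM2l ?GlG// subr_ge0 ler_piMr.
have h2 : (lam ^+ 2 - q * r s ^+ 2) * Fl s <= (lam ^+ 2 - q * r s ^+ 2) * F s.
  rewrite ler_wpM2l ?FlF// lamE.
  have : q * r s ^+ 2 <= q by rewrite ler_piMr// expr_le1// ltW.
  move: mu0 q0; lra.
(* No sign of [G] or [Gl] is known yet; [Num.max (Gl s) 0] makes the comparison with the norm of
   [G s] valid in every case. *)
have h3 : c s * Num.max (Gl s) 0 `^ p <= c s * `|G s| `^ p.
  rewrite ler_wpM2l ?mulr_ge0 ?expR_ge0 ?(ltW c00)// ge0_ler_powR ?nnegrE//.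
  - by move: p1; lra.
  - by rewrite le_max lexx orbT.
  - by rewrite ge_max normr_ge0 andbT (le_trans (GlG _ sb))// ler_norm.
lra.
Qed.
End integral_blowup.

(** * Smooth functions and cutoffs *)

Section smooth_generated.
Variables (R : realType) (V : normedModType R).

(* The algebra generated by the [h \o l], for [h] smooth on the line and [l] in
   a given set of linear functionals; being closed under directional derivatives,
   it consists of smooth functions. *)
Inductive smooth_gen (L : set (V -> R)) : (V -> R) -> Prop :=
| smooth_gen_comp (h : nat -> R -> R) (l : V -> R) of L l
    & (forall k (x : R), is_derive x (1 : R) (h k) (h k.+1 x)) :
    smooth_gen L (h 0%N \o l)
| smooth_gen_cst c : smooth_gen L (cst c)
| smooth_gen_add f g of smooth_gen L f & smooth_gen L g : smooth_gen L (f + g)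
| smooth_gen_mul f g of smooth_gen L f & smooth_gen L g : smooth_gen L (f * g)
| smooth_gen_inv f of smooth_gen L f & (forall x, f x != 0) :
    smooth_gen L (fun x => (f x)^-1).

Definition linear_diff (l : V -> R) :=
  forall x, differentiable l x /\ forall v, 'D_v l x = l v.

Lemma derive_comp_linear (h : R -> R) (l : V -> R) (dh : R) (x v : V) :
  linear_diff l -> is_derive (l x) (1 : R) h dh -> 'D_v (h \o l) x = l v * dh.
Proof.
move=> /(_ x)[dl Dl] hd; have [hd1 hd2] := hd.
have dh' : differentiable h (l x) by apply/derivable1_diffP.
rewrite deriveE; last exact: differentiable_comp.
by rewrite diff_comp// /comp diff1E// -deriveE// Dl derive1E hd2.
Qed.

Variable L : set (V -> R).
Hypothesis linL : forall l, L l -> linear_diff l.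

Lemma smooth_gen_differentiable f : smooth_gen L f -> forall x, differentiable f x.
Proof.
elim=> [h l /linL ll hh x|c x|{}f g _ hf _ hg x|{}f g _ hf _ hg x|{}f _ hf f0 x].
- apply: differentiable_comp; first by have [] := ll x.
  by apply/derivable1_diffP; have [] := hh 0%N (l x).
- exact: differentiable_cst.
- exact: differentiableD.
- exact: differentiableM.
- exact: differentiableV.
Qed.

Lemma smooth_gen_derive f v : smooth_gen L f -> smooth_gen L ('D_v f).
Proof.
have D g w x : smooth_gen L g -> derivable g x w.
  by move=> hg; exact/diff_derivable/smooth_gen_differentiable.
elim=> [h l Ll hh|c|{}f g hf hDf hg hDg|{}f g hf hDf hg hDg|{}f hf hDf f0].
- rewrite (_ : 'D_v _ = (cst (l v)) * (h 1%N \o l)).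
    apply: smooth_gen_mul; first exact: smooth_gen_cst.
    by apply: (@smooth_gen_comp _ (fun k => h k.+1)).
  by apply/funext => x; exact: derive_comp_linear (linL Ll) (hh 0%N (l x)).
- rewrite (_ : 'D_v _ = cst 0); first exact: smooth_gen_cst.
  by apply/funext => x; rewrite derive_cst.
- rewrite (_ : 'D_v _ = 'D_v f + 'D_v g); first exact: smooth_gen_add.
  by apply/funext => x; rewrite deriveD//; exact: D.
- rewrite (_ : 'D_v _ = f * 'D_v g + g * 'D_v f).
    by apply: smooth_gen_add; exact: smooth_gen_mul.
  by apply/funext => x; rewrite deriveM//; exact: D.
- rewrite (_ : 'D_v _ = cst (-1) *
    ((fun x => (f x)^-1) * (fun x => (f x)^-1)) * 'D_v f).
    apply: smooth_gen_mul => //; apply: smooth_gen_mul; first exact: smooth_gen_cst.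
    by apply: smooth_gen_mul; exact: smooth_gen_inv.
  apply/funext => x; rewrite deriveV//; last exact: D.
  by rewrite /GRing.scale /= !mulrfctE expr2 invfM mulN1r.
Qed.

Lemma smooth_gen_smooth f : smooth_gen L f -> smooth f.
Proof.
move=> hf vs; have {}hf : smooth_gen L (iter_derive vs f).
  by elim: vs => [//|v vs]; exact: smooth_gen_derive.
split=> [x|x v].
  exact/differentiable_continuous/smooth_gen_differentiable.
exact/diff_derivable/smooth_gen_differentiable.
Qed.

Lemma smooth_gen_prod (I : Type) (s : seq I) (f : I -> V -> R) :
  (forall i, smooth_gen L (f i)) -> smooth_gen L (fun x => \prod_(i <- s) f i x).
Proof.
move=> hf; elim: s => [|i s IH].
  rewrite (_ : (fun x => _) = cst 1); first exact: smooth_gen_cst.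
  by apply/funext => x; rewrite big_nil.
rewrite (_ : (fun x => _) = f i * (fun x => \prod_(i <- s) f i x)).
  exact: smooth_gen_mul.
by apply/funext => x; rewrite big_cons.
Qed.

End smooth_generated.

Lemma smooth_gen_lift (R : realType) (V W : normedModType R) (LV : set (V -> R))
    (LW : set (W -> R)) (phi : W -> V) (f : V -> R) :
  (forall l, LV l -> LW (l \o phi)) -> smooth_gen LV f -> smooth_gen LW (f \o phi).
Proof.
move=> hphi; elim=> [h l Ll hh|c|{}f g _ hf _ hg|{}f g _ hf _ hg|{}f _ hf f0].
- exact: (@smooth_gen_comp _ _ LW h (l \o phi) (hphi _ Ll) hh).
- exact: smooth_gen_cst.
- exact: (smooth_gen_add hf hg).
- exact: (smooth_gen_mul hf hg).
- by apply: (smooth_gen_inv hf) => x; exact: f0.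
Qed.

Section flat_function.
Variable R : realType.

Definition flat (q : {poly R}) (x : R) : R :=
  if 0 < x then q.[x^-1] * expR (- x^-1) else 0.

(** The [k]-th power of [t / k <= expR (t / k)]. *)
Lemma expr_expRN_le k (t : R) : 0 <= t -> t ^+ k * expR (- t) <= k%:R ^+ k.
Proof.
move=> t0; case: k => [|k]; first by rewrite !expr0 mul1r -expR0 ler_expR oppr_le0.
rewrite expRN ler_pdivrMr ?expR_gt0//.
have k0 : 0 < k.+1%:R :> R by [].
have h : t / k.+1%:R <= expR (t / k.+1%:R).
  by apply: le_trans (expR_ge1Dx _); rewrite lerDr.
have : (t / k.+1%:R) ^+ k.+1 <= expR (t / k.+1%:R) ^+ k.+1.
  by rewrite lerXn2r// nnegrE ?expR_ge0// divr_ge0.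
rewrite -expRM_natl mulrCA divff ?mulr1 ?gt_eqF// expr_div_n ler_pdivrMr ?exprn_gt0//.
by rewrite mulrC.
Qed.

Lemma horner_expRN_bounded (q : {poly R}) :
  exists C : R, forall t, 0 <= t -> `|q.[t] * expR (- t)| <= C.
Proof.
exists (\sum_(i < size q) `|q`_i| * i%:R ^+ i) => t t0.
rewrite horner_coef mulr_suml (le_trans (ler_norm_sum _ _ _))// ler_sum// => i _.
rewrite -mulrA normrM ler_wpM2l// ger0_norm ?expr_expRN_le//.
by rewrite mulr_ge0 ?expR_ge0// exprn_ge0.
Qed.

Lemma flat_le0 (q : {poly R}) (x : R) : x <= 0 -> flat q x = 0.
Proof. by rewrite leNgt /flat => /negbTE ->. Qed.

(** A factor [x] is traded for one degree of the polynomial. As every [flat] is bounded, this gives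
    continuity at 0; it also exhibits [flat ('X * q)] as the continuous slope function at 0, hence
    the derivative there. *)
Lemma flat_mulX (q : {poly R}) (x : R) : flat q x = flat ('X * q) x * x.
Proof.
rewrite /flat; case: ifPn => [x0|]; last by rewrite mul0r.
by rewrite hornerM hornerX; have : x != 0 by [rewrite gt_eqF|]; move=> ?; field.
Qed.

Lemma flat_bounded (q : {poly R}) : exists C : R, forall x, `|flat q x| <= C.
Proof.
have [C hC] := horner_expRN_bounded q; exists C => x; rewrite /flat.
case: ifPn => [x0|_]; first by rewrite hC// invr_ge0 ltW.
by rewrite normr0; apply: le_trans (hC 0 (lexx 0)).
Qed.

Lemma flat_continuous0 (q : {poly R}) : {for 0, continuous (flat q)}.
Proof.
have [C hC] := flat_bounded ('X * q).
apply/cvgrPdist_lt => e e0; rewrite (flat_le0 q (lexx 0)).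
have C1 : 0 < `|C| + 1 by rewrite ltr_wpDl.
apply/nbhs_ballP; exists (e / (`|C| + 1)); first by rewrite /= divr_gt0.
move=> y; rewrite /ball /= !sub0r !normrN ltr_pdivlMr// => ye.
apply: le_lt_trans ye; rewrite flat_mulX normrM mulrC ler_wpM2l//.
by apply: (le_trans (hC y)); rewrite (le_trans (ler_norm C))// lerDl.
Qed.

Lemma is_derive_flat (q : {poly R}) (x : R) :
  is_derive x (1 : R) (flat q) (flat ('X^2 * (q - q^`())) x).
Proof.
have [x0|x0|->] := ltgtP x 0.
- rewrite flat_le0 ?ltW//; apply: (near_eq_is_derive _ (is_derive_cst (0 : R) x (1 : R))).
  by near=> u; rewrite flat_le0// ltW//; near: u; exact: lt_nbhsl.
- have xn0 : x != 0 by rewrite gt_eqF.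
  have dinv : is_derive x (1 : R) (fun u : R => u^-1) (- x^-1 ^+ 2).
    apply: (is_derive_eq (@is_deriveV R id x 1 1 xn0 (is_derive_id x 1))).
    by rewrite /GRing.scale /= mulr1 -exprVn.
  apply: (@near_eq_is_derive _ _ _ (fun u : R => q.[u^-1] * expR (-1 * u^-1))).
    near=> u; rewrite /flat mulN1r ifT//; near: u; exact: lt_nbhsr.
  apply: (is_derive_eq (is_derive_mul
    (is_derive1_comp (is_derive_poly q x^-1) dinv)
    (is_derive_expR_comp (is_derive_mulc (-1) dinv)))).
  by rewrite /flat x0 !mulN1r !hornerE /=; ring.
- rewrite flat_le0//; apply/is_derive1_caratheodory; exists (flat ('X * q)); split.
  + by move=> z; rewrite subr0 (flat_le0 q (lexx 0)) subr0 -flat_mulX.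
  + exact: flat_continuous0.
  + exact: flat_le0.
Unshelve. all: by end_near. Qed.

Fixpoint flat_poly (k : nat) : {poly R} :=
  if k is k'.+1 then 'X^2 * (flat_poly k' - (flat_poly k')^`()) else 1.

Definition line_functional : set (R -> R) := [set id].

Lemma is_derive_affine_comp (f : R -> R) (a b x df : R) :
  is_derive (a * x + b) (1 : R) f df ->
  is_derive x (1 : R) (fun y => f (a * y + b)) (a * df).
Proof.
move=> hf; have haff : is_derive x (1 : R) (fun y => a * y + b) a.
  apply: (is_derive_eq (is_derive_add (is_derive_mulc a (is_derive_id x 1)) (is_derive_cst b x 1))).
  by rewrite mulr1 addr0.
by apply: (is_derive_eq (@is_derive1_comp _ f (fun y => a * y + b) _ _ _ hf haff)); rewrite mulrC.
Qed.

Lemma smooth_gen_flat (a b : R) : smooth_gen line_functional (fun x => flat 1 (a * x + b)).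
Proof.
pose h k (x : R) := a ^+ k * flat (flat_poly k) (a * x + b).
have -> : (fun x => flat 1 (a * x + b)) = h 0%N \o id.
  by apply/funext => x; rewrite /h /= mul1r.
apply: smooth_gen_comp => // k x; rewrite /h exprSr -mulrA.
by apply: is_derive_mulc; apply: is_derive_affine_comp; exact: is_derive_flat.
Qed.

Definition smooth_step (x : R) : R := flat 1 x / (flat 1 x + flat 1 (1 - x)).

Lemma flat1_ge0 x : 0 <= flat 1 x.
Proof. by rewrite /flat; case: ifP => // _; rewrite hornerE mul1r expR_ge0. Qed.

Lemma flat1_gt0 x : 0 < x -> 0 < flat 1 x.
Proof. by rewrite /flat => ->; rewrite hornerE mul1r expR_gt0. Qed.

Lemma smooth_step_den_gt0 x : 0 < flat 1 x + flat 1 (1 - x).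
Proof.
have [x0|x0] := ltP 0 x; first by rewrite ltr_wpDr ?flat1_ge0 ?flat1_gt0.
by rewrite ltr_wpDl ?flat1_ge0 ?flat1_gt0//; lra.
Qed.

Lemma smooth_step_ge0 x : 0 <= smooth_step x.
Proof. by rewrite divr_ge0 ?flat1_ge0// ltW// smooth_step_den_gt0. Qed.

Lemma smooth_step_le0 x : x <= 0 -> smooth_step x = 0.
Proof. by move=> x0; rewrite /smooth_step flat_le0// mul0r. Qed.

Lemma smooth_step_ge1 x : 1 <= x -> smooth_step x = 1.
Proof.
move=> x1; rewrite /smooth_step (@flat_le0 _ (1 - x)) ?addr0; last by lra.
by rewrite divff// gt_eqF// flat1_gt0//; lra.
Qed.

Lemma smooth_gen_step (a b : R) :
  smooth_gen line_functional (fun x => smooth_step (a * x + b)).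
Proof.
apply: smooth_gen_mul; first exact: smooth_gen_flat.
apply: smooth_gen_inv => [|x]; last by rewrite gt_eqF// smooth_step_den_gt0.
apply: smooth_gen_add; first exact: smooth_gen_flat.
rewrite (_ : (fun x => _) = (fun x => flat 1 (- a * x + (1 - b)))).
  exact: smooth_gen_flat.
by apply/funext => x; congr flat; ring.
Qed.

Lemma smooth_gen_expR (a : R) : smooth_gen line_functional (fun x => expR (a * x)).
Proof.
pose h k (x : R) := a ^+ k * expR (a * x).
have -> : (fun x => expR (a * x)) = h 0%N \o id.
  by apply/funext => x; rewrite /h /= mul1r.
apply: smooth_gen_comp => // k x; rewrite /h exprSr -mulrA.
apply: is_derive_mulc; apply: (is_derive_eq (is_derive_expR_comp (is_derive_mulc a (is_derive_id x 1)))).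
by rewrite mulr1 mulrC.
Qed.

End flat_function.

(** * The truncated plane wave *)

Section plane_wave_cutoff.
Variables (R : realType) (m : nat).
Local Notation space := 'rV[R]_m.+1.
Local Notation lebn := (lebesgue_rV R m.+1).

Definition coord (i : 'I_m.+1) (x : space) : R := x ord0 i.

Definition space_functional : set (space -> R) := [set l | exists i, l = coord i].

Definition spacetime_functional : set (R * space -> R) :=
  [set l | l = fst \/ exists i, l = coord i \o snd].

Lemma linear_diff_lin (V : normedModType R) (l : V -> R) :
  (forall a u v, l (a *: u + v) = a * l u + l v) -> continuous l -> linear_diff l.
Proof.
move=> lin cl x.
pose lM := GRing.isLinear.Build R V R *%R l lin.
pose L : {linear V -> R} := HB.pack l lM.
have dl : differentiable l x by exact: (@linear_differentiable _ _ _ L).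
by split=> // v; rewrite deriveE// (@diff_lin _ _ _ L).
Qed.

Lemma linear_diff_coord l : space_functional l -> linear_diff l.
Proof.
move=> [i ->]; apply: linear_diff_lin => [a u v|]; first by rewrite /coord !mxE.
exact: coord_continuous.
Qed.

Lemma linear_diff_spacetime l : spacetime_functional l -> linear_diff l.
Proof.
move=> [->|[i ->]]; apply: linear_diff_lin => //.
- by move=> z; exact: cvg_fst.
- by move=> a u v; rewrite /coord /= !mxE.
- move=> z; apply: (@continuous_comp _ _ _ snd (coord i)); first exact: cvg_snd.
  exact: coord_continuous.
Qed.

Definition box (r : R) : set space := [set x | forall i, `|x ord0 i| <= r].

Lemma compact_box r : compact (box r).
Proof.
rewrite (_ : box r = [set x : space | forall i, `[-r, r]%classic (x ord0 i)]).
  by apply: (@rV_compact R _ (fun=> `[-r, r]%classic)) => i; exact: segment_compact.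
by apply/seteqP; split=> x hx i; have := hx i; rewrite /= in_itv /= ler_norml.
Qed.

Lemma measurable_box r : measurable (box r).
Proof.
rewrite (_ : box r = \bigcap_(i in [set: 'I_m.+1]) (coord i @^-1` `[-r, r]%classic)).
  apply: fin_bigcap_measurable => // i _; rewrite -[X in measurable X]setTI.
  by apply: measurable_rV_coord.
apply/seteqP; split=> x hx i; first by move=> _; have := hx i; rewrite /= in_itv /= ler_norml.
by have := hx i I; rewrite /= in_itv /= ler_norml.
Qed.

Lemma lebesgue_box_lty r : (lebn (box r) < +oo)%E.
Proof.
rewrite (_ : box r = [set x : space | forall i, `[-r, r]%classic (x ord0 i)]); last first.
  by apply/seteqP; split=> x hx i; have := hx i; rewrite /= in_itv /= ler_norml.
rewrite (@lebesgue_rV_box R _ (fun=> `[-r, r]%classic))//.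
rewrite -ge0_fin_numE ?prode_ge0// prode_fin_num// => i _.
by rewrite lebesgue_measure_itv; case: ifP.
Qed.

(** The sigma-algebra on row vectors is generated by the coordinates, so measurability is read off
    the generation of [f] and not from its continuity. *)
Lemma smooth_gen_measurable (f : space -> R) : smooth_gen space_functional f ->
  measurable_fun setT f.
Proof.
elim=> [h l [i ->] hh|c|{}f g _ hf _ hg|{}f g _ hf _ hg|{}f _ hf f0].
- apply: measurableT_comp; last exact: measurable_rV_coord.
  apply: continuous_measurable_fun => x; exact: is_derive_continuous (hh 0%N x).
- exact: measurable_cst.
- exact: measurable_funD.
- exact: measurable_funM.
(* The inverse is written [f * (f ^ 2) ^ (-1)]: a real power is measurable, and it agrees with the
   inverse on the nonnegative base [f * f]. *)
- rewrite (_ : (fun x => _) = f \* (fun x => (f x * f x) `^ (-1))).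
    apply: measurable_funM => //; apply: (measurableT_comp (measurable_powR _)).
    exact: measurable_funM.
  by apply/funext => x /=; rewrite powR_inv1 ?mulrA -?expr2 ?sqr_ge0// expr2 invfM mulrA divff ?mul1r.
Qed.


Definition cutoff (r x : R) : R := smooth_step (1 * x + (r + 1)) * smooth_step (-1 * x + (r + 1)).

Lemma cutoff_eq1 r x : `|x| <= r -> cutoff r x = 1.
Proof.
rewrite ler_norml => /andP[x1 x2].
by rewrite /cutoff !smooth_step_ge1 ?mulr1//; lra.
Qed.

Lemma cutoff_eq0 r x : r + 1 <= `|x| -> cutoff r x = 0.
Proof.
rewrite ler_normr => /orP[x1|x1]; rewrite /cutoff.
  by rewrite (@smooth_step_le0 _ (-1 * x + _)) ?mulr0//; lra.
by rewrite smooth_step_le0 ?mul0r//; lra.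
Qed.

Variables (lam r : R).

(** The truncation is to a box, coordinate by coordinate, so that the whole function is a product of
    smooth functions of one coordinate. *)
Definition plane_cutoff (x : space) : R :=
  expR (lam * coord ord0 x) * \prod_(i < m.+1) cutoff r (coord i x).

Lemma plane_cutoff_ge0 x : 0 <= plane_cutoff x.
Proof.
by rewrite mulr_ge0 ?expR_ge0// prodr_ge0// => i _; rewrite mulr_ge0 ?smooth_step_ge0.
Qed.

Lemma plane_cutoffE x : box r x -> plane_cutoff x = expR (lam * coord ord0 x).
Proof.
by move=> xr; rewrite /plane_cutoff big1 ?mulr1// => i _; apply: cutoff_eq1; exact: xr.
Qed.

Lemma plane_cutoff_eq0 x : ~ box (r + 1) x -> plane_cutoff x = 0.
Proof.
move=> /existsNP[i /negP]; rewrite -ltNge => /ltW xi.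
by rewrite /plane_cutoff (bigD1 i)//= cutoff_eq0 ?mul0r ?mulr0.
Qed.

Lemma smooth_gen_coord (f : R -> R) i : smooth_gen (@line_functional R) f ->
  smooth_gen space_functional (f \o coord i).
Proof. by apply: smooth_gen_lift => l ->; exists i. Qed.

Lemma smooth_gen_plane_cutoff : smooth_gen space_functional plane_cutoff.
Proof.
apply: smooth_gen_mul.
  exact: (smooth_gen_coord ord0 (smooth_gen_expR lam)).
apply: smooth_gen_prod => i; apply: (smooth_gen_coord i (f := cutoff r)).
by apply: smooth_gen_mul; exact: smooth_gen_step.
Qed.

Lemma derive_eq0_outside (f : space -> R) v x : ~ box (r + 1) x ->
  (forall y, ~ box (r + 1) y -> f y = 0) -> 'D_v f x = 0.
Proof.
move=> bx f0; rewrite -(derive_cst (0 : R) x v); apply: near_eq_derive.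
have : open (~` box (r + 1)).
  by apply: closed_openC; apply: compact_closed (@compact_box (r + 1)); exact: norm_hausdorff.
move=> ob; have := open_nbhs_nbhs (conj ob bx); apply: filterS => y; exact: f0.
Qed.

Lemma test_function_smooth_gen (f : space -> R) : smooth_gen space_functional f ->
  (forall y, ~ box (r + 1) y -> f y = 0) -> test_function f.
Proof.
move=> hf f0; split; first exact: smooth_gen_smooth linear_diff_coord _ hf.
by exists (box (r + 1)); split=> //; exact: compact_box.
Qed.

Lemma bounded_smooth_gen (f : space -> R) : smooth_gen space_functional f ->
  (forall y, ~ box (r + 1) y -> f y = 0) -> exists C : R, forall x, `|f x| <= C.
Proof.
move=> hf f0.
have cf : {within box (r + 1), continuous f}.
  apply: continuous_subspaceT => x; apply: differentiable_continuous.
  exact: smooth_gen_differentiable linear_diff_coord _ hf x.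
have [C [_ hC]] := compact_bounded (continuous_compact cf (@compact_box (r + 1))).
exists (`|C| + 1) => x; have C1 : C < `|C| + 1 by rewrite ltr_pwDr// ler_norm.
have [bx|bx] := pselect (box (r + 1) x); last by rewrite f0// normr0 addr_ge0.
by apply: (hC _ C1); exists x.
Qed.

Lemma near_box_lt (x : space) : (forall i, `|x ord0 i| < r) ->
  \forall y \near x, forall i, `|(y : space) ord0 i| < r.
Proof.
move=> xr; apply: (@filter_forall _ _ (fun i (y : space) => `|y ord0 i| < r) _ (nbhs_filter x)) => i.
have : {for x, continuous (fun y : space => `|y ord0 i|)}.
  apply: (@continuous_comp _ _ _ (coord i) (@Num.norm _ R)); last exact: norm_continuous.
  exact: coord_continuous.
move=> /cvgr_lt; apply; exact: xr.
Qed.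

Lemma near_box (x : space) : (forall i, `|x ord0 i| < r) -> \forall y \near x, box r y.
Proof. by move=> /near_box_lt; apply: filterS => y yr i; rewrite ltW. Qed.

(** The inequalities are strict because each differentiation needs equality with the pure
    exponential on a neighbourhood. Summed over [i], this says that the Laplacian of the wave is
    [lam ^+ 2] times the wave, wherever the cutoff is invisible. *)
Lemma derive2_plane_cutoff (i : 'I_m.+1) (x : space) : (forall i, `|x ord0 i| < r) ->
  'D_(basis_vec R i) ('D_(basis_vec R i) plane_cutoff) x =
  if i == ord0 then lam ^+ 2 * plane_cutoff x else 0.
Proof.
move=> xr; pose e := basis_vec R i : space.
have lc : linear_diff (@coord ord0) by apply: linear_diff_coord; exists ord0.
have hd (c s : R) : is_derive s (1 : R) (fun s => c * expR (lam * s)) (c * (expR (lam * s) * lam)).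
  apply: is_derive_mulc.
  by apply: (is_derive_eq (is_derive_expR_comp (is_derive_mulc lam (is_derive_id s 1)))); rewrite mulr1.
have dE (y : space) : (forall i, `|y ord0 i| < r) ->
    'D_e plane_cutoff y = e ord0 ord0 * lam * expR (lam * coord ord0 y).
  move=> yr; rewrite (near_eq_derive (g := (fun s => 1 * expR (lam * s)) \o coord ord0)); last first.
    by have := near_box yr; apply: filterS => z zb; rewrite plane_cutoffE//= mul1r.
  by rewrite (derive_comp_linear e lc (hd _ _)) /coord; ring.
rewrite (near_eq_derive (g := (fun s => e ord0 ord0 * lam * expR (lam * s)) \o coord ord0)); last first.
  by have := near_box_lt xr; apply: filterS => y; exact: dE.
rewrite (derive_comp_linear e lc (hd _ _)).
have -> : coord ord0 e = (i == ord0)%:R by rewrite /coord mxE eqxx eq_sym.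
have -> : e ord0 ord0 = (i == ord0)%:R by rewrite mxE eqxx eq_sym.
case: eqP => _; last by rewrite mul0r.
by rewrite plane_cutoffE => [|j]; [rewrite !mul1r; ring|exact: ltW].
Qed.

Lemma smooth_gen_derive_coord (f : space -> R) v :
  smooth_gen space_functional f -> smooth_gen space_functional ('D_v f).
Proof. exact: smooth_gen_derive linear_diff_coord _ v. Qed.

End plane_wave_cutoff.

Section spacetime_cutoff.
Variables (R : realType) (m : nat).
Local Notation space := 'rV[R]_m.+1.
Variables (mu t1 t2 : R) (psi : space -> R) (rho : R).
Hypotheses (t1_ge0 : 0 <= t1) (t12 : t1 < t2)
  (psi_gen : smooth_gen (@space_functional R m) psi)
  (psi0 : forall x, ~ box rho x -> psi x = 0).

(* The factor [expR (mu * s)] turns the damping coefficient [- mu / (1 + s)] into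
   [mu - mu / (1 + s)], which is nonnegative. *)
Definition time_cutoff (s : R) : R :=
  expR (mu * s) * smooth_step (- (2 / (t2 - t1)) * s + 2 / (t2 - t1) * t2).

Definition spacetime_cutoff (z : R * space) : R := time_cutoff z.1 * psi z.2.

(** The argument of the step is [2 * (t2 - s) / (t2 - t1)], which is at least 1 up to the midpoint.
    The plateau thus extends beyond [t1], and time derivatives up to and including [t1] see only the
    exponential. *)
Lemma time_cutoffE s : s <= (t1 + t2) / 2 -> time_cutoff s = expR (mu * s).
Proof.
move=> st; rewrite /time_cutoff smooth_step_ge1 ?mulr1// mulNr addrC -mulrBr.
have t0 : 0 < t2 - t1 by move: t12; lra.
by rewrite mulrAC ler_pdivlMr// mul1r; move: st; lra.
Qed.

Lemma time_cutoff_eq0 s : t2 <= s -> time_cutoff s = 0.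
Proof.
move=> st; rewrite /time_cutoff smooth_step_le0 ?mulr0// mulNr addrC -mulrBr.
have t0 : 0 < t2 - t1 by move: t12; lra.
by rewrite mulr_ge0_le0 ?divr_ge0 ?(ltW t0)//; move: st; lra.
Qed.

Lemma smooth_gen_time_cutoff : smooth_gen (@line_functional R) time_cutoff.
Proof. by apply: smooth_gen_mul; [exact: smooth_gen_expR|exact: smooth_gen_step]. Qed.

Lemma smooth_gen_time_lift : smooth_gen (@spacetime_functional R m) (time_cutoff \o fst).
Proof. by apply: (smooth_gen_lift _ smooth_gen_time_cutoff) => l ->; left. Qed.

Lemma smooth_gen_space_lift : smooth_gen (@spacetime_functional R m) (psi \o snd).
Proof. by apply: (smooth_gen_lift _ psi_gen) => l [i ->]; right; exists i. Qed.

Lemma spacetime_cutoff_test (T : \bar R) : (t2%:E < T)%E ->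
  spacetime_test_function T spacetime_cutoff.
Proof.
move=> tT; split.
  apply: smooth_gen_smooth (@linear_diff_spacetime R m) _ _.
  exact: (smooth_gen_mul smooth_gen_time_lift smooth_gen_space_lift).
exists (`[0, t2]%classic `*` box rho); split.
- by apply: compact_setX; [exact: segment_compact|exact: compact_box].
- move=> [s x] [/=]; rewrite in_itv /= => /andP[s0 st] _; split=> //; split=> //=.
  by apply: le_lt_trans tT; rewrite lee_fin.
- move=> [s x] /= [/= s0 _] h; rewrite /spacetime_cutoff /=.
  have [st|st] := leP t2 s; first by rewrite time_cutoff_eq0 ?mul0r.
  rewrite psi0 ?mulr0// => bx; apply: h; split=> //=.
  by rewrite in_itv /= s0 ltW.
Qed.

Lemma derivable_time_lift z w : derivable (time_cutoff \o fst : R * space -> R) z w.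
Proof.
apply/diff_derivable/smooth_gen_differentiable; last exact: smooth_gen_time_lift.
exact: linear_diff_spacetime.
Qed.

Lemma derivable_space_lift z w : derivable (psi \o snd : R * space -> R) z w.
Proof.
apply/diff_derivable/smooth_gen_differentiable; last exact: smooth_gen_space_lift.
exact: linear_diff_spacetime.
Qed.

Lemma dt_spacetime_cutoff s x : s <= t1 ->
  dt spacetime_cutoff s x = mu * expR (mu * s) * psi x.
Proof.
move=> st; rewrite /dt (_ : spacetime_cutoff = (time_cutoff \o fst) * (psi \o snd))//.
rewrite deriveM; [|exact: derivable_time_lift|exact: derivable_space_lift].
have -> : 'D_(1, 0) (psi \o snd : R * space -> R) (s, x) = 'D_0 psi x by [].
have -> : 'D_(1, 0) (time_cutoff \o fst : R * space -> R) (s, x) = 'D_1 time_cutoff s by [].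
rewrite derive0 scaler0 add0r.
rewrite (near_eq_derive (g := fun s => expR (mu * s))); last first.
  near=> u; apply: time_cutoffE; apply: ltW; near: u; apply: lt_nbhsl.
  by move: t12 st; lra.
have [_ ->] := is_derive_expR_comp (is_derive_mulc mu (is_derive_id s 1)).
by rewrite /GRing.scale /= mulr1; ring.
Unshelve. all: by end_near. Qed.

Lemma dx_spacetime_cutoff i s x : s <= t1 ->
  dx i spacetime_cutoff s x = expR (mu * s) * 'D_(basis_vec R i) psi x.
Proof.
move=> st; rewrite /dx (_ : spacetime_cutoff = (time_cutoff \o fst) * (psi \o snd))//.
rewrite deriveM; [|exact: derivable_time_lift|exact: derivable_space_lift].
have -> : 'D_(0, basis_vec R i) (psi \o snd : R * space -> R) (s, x) = 'D_(basis_vec R i) psi x by [].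
have -> : 'D_(0, basis_vec R i) (time_cutoff \o fst : R * space -> R) (s, x) = 'D_0 time_cutoff s by [].
by rewrite derive0 scaler0 addr0 /= time_cutoffE//; move: t12 st; lra.
Qed.

End spacetime_cutoff.

(** * Pairings in the space of square integrable functions *)

Section L2_pairing.
Context d (T : measurableType d) (R : realType) (nu : {measure set T -> \bar R}).
Implicit Types f g : T -> R.

Lemma L2_measurable f : f \in Lfun nu 2%:E -> measurable_fun setT f.
Proof. by rewrite inE => /andP[]; rewrite inE. Qed.

Lemma L2_lty f : f \in Lfun nu 2%:E -> ('N[nu]_2%:E [EFin \o f] < +oo)%E.
Proof. by rewrite inE => /andP[_]; rewrite inE. Qed.

Lemma L2D f g : f \in Lfun nu 2%:E -> g \in Lfun nu 2%:E ->
  (fun x => f x + g x) \in Lfun nu 2%:E.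
Proof.
have h := @Lfun_submod_closed _ T R nu 2%:E (lee1n 2).
move=> hf hg; have := h.2 1 f g hf hg.
by rewrite (_ : 1 *: f + g = fun x => f x + g x)//; apply/funext => x; rewrite scale1r.
Qed.

Lemma L2Z f (a : R) : f \in Lfun nu 2%:E -> (fun x => a * f x) \in Lfun nu 2%:E.
Proof.
have h := @Lfun_submod_closed _ T R nu 2%:E (lee1n 2).
move=> hf; have := h.2 a f (cst 0) hf h.1.
by rewrite (_ : a *: f + _ = fun x => a * f x)//; apply/funext => x; rewrite /= addr0.
Qed.

Lemma L2B f g : f \in Lfun nu 2%:E -> g \in Lfun nu 2%:E ->
  (fun x => f x - g x) \in Lfun nu 2%:E.
Proof.
move=> hf /(L2Z (-1)) hg; rewrite (_ : (fun x => _) = fun x => f x + -1 * g x).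
  exact: L2D.
by apply/funext => x; rewrite mulN1r.
Qed.

Lemma L2_integrable_mul f g : f \in Lfun nu 2%:E -> g \in Lfun nu 2%:E ->
  nu.-integrable setT (EFin \o (fun x => f x * g x)).
Proof. by move=> hf hg; apply/Lfun1_integrable; exact: Lfun2_mul_Lfun1. Qed.

Lemma EFin_integrableB (D : set T) f g : measurable D ->
  nu.-integrable D (EFin \o f) -> nu.-integrable D (EFin \o g) ->
  nu.-integrable D (EFin \o (fun x => f x - g x)).
Proof.
move=> mD hf hg; rewrite (_ : EFin \o _ = ((EFin \o f) \- (EFin \o g))%E).
  exact: integrableB.
by apply/funext.
Qed.

Lemma EFin_integrableD (D : set T) f g : measurable D ->
  nu.-integrable D (EFin \o f) -> nu.-integrable D (EFin \o g) ->
  nu.-integrable D (EFin \o (fun x => f x + g x)).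
Proof.
move=> mD hf hg; rewrite (_ : EFin \o _ = ((EFin \o f) \+ (EFin \o g))%E).
  exact: integrableD.
by apply/funext.
Qed.

Lemma EFin_integrableZ (D : set T) (a : R) f : measurable D ->
  nu.-integrable D (EFin \o f) -> nu.-integrable D (EFin \o (fun x => a * f x)).
Proof.
move=> mD hf; rewrite (_ : EFin \o _ = fun x => (a%:E * (EFin \o f) x)%E).
  exact: integrableZl.
by apply/funext.
Qed.

Lemma L2_bounded (B : set T) (C : R) g : measurable B -> (nu B < +oo)%E ->
  measurable_fun setT g -> (forall x, `|g x| <= C) -> (forall x, ~ B x -> g x = 0) ->
  g \in Lfun nu 2%:E.
Proof.
move=> mB Boo mg gC g0; rewrite inE; apply/andP; split; rewrite inE//=.
rewrite /finite_norm unlock; apply: poweR_lty.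
rewrite (_ : (fun x => _) = (fun x => (`|g x| `^ 2)%:E)); last first.
  by apply/funext.
apply: (@le_lt_trans _ _ (\int[nu]_(x in B) (C `^ 2)%:E)%E); last first.
  by rewrite integral_cst// lte_mul_pinfty// ?lee_fin ?powR_ge0.
have C0 (x : T) : 0 <= C by apply: le_trans (gC x).
rewrite [leRHS]integral_mkcond; apply: ge0_le_integral => //.
- apply/measurable_EFinP; apply: (measurableT_comp (measurable_powR _)).
  exact: measurableT_comp.
- by apply/(measurable_restrictT _ mB).1; exact: measurable_cst.
- move=> x _; rewrite patchE; case: ifPn => [xB|/negP xB].
    by rewrite lee_fin ge0_ler_powR// ?nnegrE// (C0 x).
  by rewrite g0 ?normr0 ?powR0// => Bx; apply: xB; rewrite inE.
Qed.

Lemma L2_pairing_le f g : f \in Lfun nu 2%:E -> g \in Lfun nu 2%:E ->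
  (`|\int[nu]_x (f x * g x)|%:E <=
     'N[nu]_2%:E [EFin \o f] * 'N[nu]_2%:E [EFin \o g])%E.
Proof.
move=> hf hg; have hfg := L2_integrable_mul hf hg.
rewrite EFin_normr_Rintegral//.
apply: (@le_trans _ _ ('N[nu]_1 [EFin \o (f \* g)%R])%E).
  rewrite Lnorm1; apply: le_abse_integral => //.
  exact: measurable_int hfg.
apply: hoelder => //; [exact: L2_measurable..|by rewrite [RHS]splitr !div1r].
Qed.

Lemma L2_pairing_cvg (I : Type) (F : set_system I) (v : I -> T -> R) g :
  Filter F -> (\forall i \near F, v i \in Lfun nu 2%:E) -> g \in Lfun nu 2%:E ->
  ('N[nu]_2%:E [EFin \o v i] @[i --> F] --> 0)%E ->
  \int[nu]_x (v i x * g x) @[i --> F] --> (0 : R).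
Proof.
move=> FF hv hg /fine_cvgP[hfin /cvgrPdist_lt hcvg].
set K := fine ('N[nu]_2%:E [EFin \o g])%E.
have Kfin : ('N[nu]_2%:E [EFin \o g])%E \is a fin_num.
  by rewrite ge0_fin_numE ?Lnorm_ge0 ?L2_lty.
have K0 : 0 <= K by rewrite fine_ge0 ?Lnorm_ge0.
apply/cvgrPdist_lt => e e0.
have e1 : 0 < e / (K + 1) by rewrite divr_gt0// ltr_wpDl.
near=> i; rewrite sub0r normrN.
have hvi : v i \in Lfun nu 2%:E by near: i.
have fi : ('N[nu]_2%:E [EFin \o v i])%E \is a fin_num by near: i.
have : `|0 - fine ('N[nu]_2%:E [EFin \o v i])%E| < e / (K + 1) by near: i; exact: hcvg.
rewrite sub0r normrN ger0_norm ?fine_ge0 ?Lnorm_ge0// ltr_pdivlMr ?ltr_wpDl// => h.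
apply: le_lt_trans h; rewrite -lee_fin; apply: le_trans (L2_pairing_le hvi hg) _.
rewrite -(fineK fi) -(fineK Kfin) -EFinM lee_fin ler_wpM2l ?fine_ge0 ?Lnorm_ge0//.
by rewrite lerDl.
Unshelve. all: by end_near. Qed.

Lemma Rintegral_ae_eq f g : measurable_fun setT f -> measurable_fun setT g ->
  {ae nu, forall x, f x = g x} -> \int[nu]_x f x = \int[nu]_x g x.
Proof.
move=> mf mg fg; congr fine; apply: ae_eq_integral => //.
- exact/measurable_EFinP.
- exact/measurable_EFinP.
- by apply: filterS fg => x /= ->.
Qed.

End L2_pairing.

(** * From essential supports to vanishing almost everywhere *)

Section essential_support.
Variables (R : realType) (m : nat).
Local Notation space := 'rV[R]_m.+1.
Local Notation lebn := (lebesgue_rV R m.+1).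

Lemma smooth_gen_sum_sqr (s : seq 'I_m.+1) :
  smooth_gen (@space_functional R m) (fun x => \sum_(i <- s) x ord0 i ^+ 2).
Proof.
pose h k (x : R) : R := if k is k'.+1 then (k' == 0%N)%:R else x.
have hid : smooth_gen (@line_functional R) id.
  apply: (smooth_gen_comp (h := h)) => // -[|k] x; first exact: is_derive_id.
  exact: is_derive_cst.
elim: s => [|i s IH].
  rewrite (_ : (fun x => _) = cst 0); first exact: smooth_gen_cst.
  by apply/funext => x; rewrite big_nil.
rewrite (_ : (fun x => _) = (id \o coord i) * (id \o coord i) +
    (fun x : space => \sum_(i <- s) x ord0 i ^+ 2)).
  by apply: smooth_gen_add => //; apply: smooth_gen_mul; exact: smooth_gen_coord.
by apply/funext => x; rewrite big_cons expr2.
Qed.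

Lemma continuous_euclidean_norm : continuous (@euclidean_norm R m.+1).
Proof.
move=> x; apply: (@continuous_comp _ _ _ (fun x : space => \sum_(i < m.+1) x ord0 i ^+ 2)
  (@Num.sqrt R)); last exact: sqrt_continuous.
apply: differentiable_continuous.
exact: smooth_gen_differentiable (@linear_diff_coord R m) _ (smooth_gen_sum_sqr _) x.
Qed.

Lemma open_open_ball (r : R) : open (@open_ball R m.+1 r).
Proof.
rewrite (_ : open_ball r = @euclidean_norm R m.+1 @^-1` [set y | y < r]) //.
apply: open_comp; last exact: open_lt.
by move=> x _; exact: continuous_euclidean_norm.
Qed.

Lemma measurable_euclidean_norm : measurable_fun setT (@euclidean_norm R m.+1).
Proof.
rewrite (_ : @euclidean_norm R m.+1 =
  @Num.sqrt R \o (fun x : space => \sum_(i < m.+1) x ord0 i ^+ 2))//.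
apply: measurableT_comp; first exact: continuous_measurable_fun (@sqrt_continuous R).
exact: smooth_gen_measurable (smooth_gen_sum_sqr _).
Qed.

Lemma measurable_open_ball (r : R) : measurable (@open_ball R m.+1 r).
Proof.
rewrite (_ : open_ball r = setT `&` @euclidean_norm R m.+1 @^-1` `]-oo, r[%classic); last first.
  by apply/seteqP; split => [x xr|x []]; rewrite /= in_itv.
exact: measurable_euclidean_norm.
Qed.

Lemma coord_le_euclidean_norm (x : space) i : `|x ord0 i| <= euclidean_norm x.
Proof.
rewrite -sqrtr_sqr ler_sqrt ?sumr_ge0// => [|j _]; last exact: sqr_ge0.
by rewrite (bigD1 i)//= lerDl sumr_ge0// => j _; exact: sqr_ge0.
Qed.

Lemma open_ball_box (r : R) : @open_ball R m.+1 r `<=` box r.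
Proof. by move=> x /ltW xr i; apply: le_trans xr; exact: coord_le_euclidean_norm. Qed.

(* A compact set off the essential support is covered by null sets; the covering
   property of compact sets is applied to the filter of co-null sets. *)
Lemma ae_eq0_off_support (f : space -> R) r : ess_support f `<=` open_ball r ->
  {ae lebn, forall x, ~ open_ball r x -> f x = 0}.
Proof.
move=> sf; suff : forall k : nat, {ae lebn, forall x, box k%:R x -> ~ open_ball r x -> f x = 0}.
  move=> /ae_foralln; apply: filterS => x h; apply: (h (Num.truncn (euclidean_norm x)).+1).
  move=> i; apply: le_trans (coord_le_euclidean_norm x i) _.
  by apply: ltW; apply: truncnS_gt.
move=> k; have cK : compact (box k%:R `&` ~` (@open_ball R m.+1 r)).
  apply: compact_closedI; first exact: compact_box.
  by apply: open_closedC; exact: open_open_ball.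
have /compact_near_coveringP/(_ _ (almost_everywhere lebn)
  (fun y x => x = y -> f y = 0)) := cK.
move=> /(_ (ae_filter_ringOfSetsType _)) h; apply: filterS (h _) => [y hy ky by_|x [kx bx]].
  exact: (hy y (conj ky by_) erefl).
have : ~ ess_support f x by move/sf.
move=> /contrapT[U Ux Uae]; exists (U, [set y | U y -> f y = 0]) => //=.
by move=> [x' y] /= [Ux' h'] xy; apply: h'; rewrite -xy.
Qed.

End essential_support.

(** * The mass of the plane wave on a ball *)

Section ball_volume.
Variables (R : realType) (m : nat).
Local Notation space := 'rV[R]_m.+1.
Local Notation lebn := (lebesgue_rV R m.+1).
Local Notation lebm := (lebesgue_rV R m).
Local Notation leb1 := (@lebesgue_measure R).

Lemma integral_lebesgue_rVS (f : space -> \bar R) : measurable_fun setT f ->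
  (forall x, 0 <= f x)%E ->
  (\int[lebn]_x f x = \int[leb1]_a \int[lebm]_y f (rV_cons (a, y)))%E.
Proof.
move=> mf f0.
rewrite (_ : (\int[lebn]_x f x =
    \int[pushforward (leb1 \x lebm)%E (@rV_cons R m)]_(x in setT) f x)%E)//.
rewrite (ge0_integral_pushforward (@measurable_rV_cons R m))//.
rewrite preimage_setT fubini_tonelli1//; last by move=> x; exact: f0.
by apply: measurableT_comp => //; exact: measurable_rV_cons.
Qed.

Lemma integral_expR_itv (c k rho : R) : 0 <= c -> 0 < k -> 0 < rho ->
  (\int[leb1]_(a in `[(- rho)%R, rho]) (c * expR (k * a))%:E <= (c / k * expR (k * rho))%:E)%E.
Proof.
move=> c0 k0 r0; pose F a := c / k * expR (k * a).
have dF (a : R) : is_derive a (1 : R) F (c * expR (k * a)).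
  apply: (is_derive_eq (is_derive_mulc _ (is_derive_expR_comp (is_derive_mulc k (is_derive_id a 1))))).
  by have : k != 0 by [rewrite gt_eqF|]; move=> ?; field.
have cF (a : R) : {for a, continuous F} by exact: is_derive_continuous (dF a).
rewrite (@continuous_FTC2 R (fun a => c * expR (k * a)) F).
- by rewrite -EFinB lee_fin /F gerDl oppr_le0 mulr_ge0 ?expR_ge0// divr_ge0// ltW.
- lra.
- apply: continuous_subspaceT => a; apply: cvgM; first exact: cvg_cst.
  exact: is_derive_continuous (is_derive_expR_comp (is_derive_mulc k (is_derive_id a 1))).
- split; first by move=> a _; have [] := dF a.
    by apply: cvg_at_right_filter; exact: cF.
  by apply: cvg_at_left_filter; exact: cF.
- by move=> a _; rewrite derive1E; have [_ ->] := dF a.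
Qed.

Lemma sqrt_expr_le (k : R) : 0 < k -> exists2 K : R, 0 <= K &
  forall s, 0 <= s -> Num.sqrt s ^+ m <= K * expR (k * s).
Proof.
move=> k0; exists (m%:R ^+ m / k ^+ m * expR k).
  by rewrite mulr_ge0 ?expR_ge0// divr_ge0 ?exprn_ge0// ltW.
move=> s s0; apply: (@le_trans _ _ ((1 + s) ^+ m)).
  rewrite lerXn2r ?nnegrE ?sqrtr_ge0 ?addr_ge0//.
  rewrite -(@ler_sqr R) ?nnegrE ?sqrtr_ge0 ?addr_ge0// sqr_sqrtr//; nra.
have s1 : 0 <= 1 + s by rewrite addr_ge0.
have := @expr_expRN_le R m (k * (1 + s)) (mulr_ge0 (ltW k0) s1).
rewrite expRN ler_pdivrMr ?expR_gt0// exprMn mulrDr mulr1 expRD => h.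
have km : 0 < k ^+ m by rewrite exprn_gt0.
rewrite -(ler_pM2l km) (le_trans h)// le_eqVlt; apply/orP; left; apply/eqP.
by have : k ^+ m != 0 by [rewrite gt_eqF|]; move=> ?; field.
Qed.

Lemma ball_section (rho a : R) (y : 'rV[R]_m) : open_ball rho (rV_cons (a, y)) ->
  `|a| <= rho /\ forall i, `[- Num.sqrt (rho ^+ 2 - a ^+ 2), Num.sqrt (rho ^+ 2 - a ^+ 2)]%classic (y ord0 i).
Proof.
rewrite /open_ball /= => h.
have rho0 : 0 <= rho by apply: ltW; apply: le_lt_trans h; exact: sqrtr_ge0.
have sq : a ^+ 2 + \sum_(i < m) y ord0 i ^+ 2 < rho ^+ 2.
  move: h; rewrite /euclidean_norm big_ord_recl rV_cons0 /=.
  under eq_bigr do rewrite rV_consS /=.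
  rewrite -(@ltr_sqr R) ?nnegrE ?sqrtr_ge0// sqr_sqrtr// addr_ge0 ?sqr_ge0//.
  by rewrite sumr_ge0// => i _; exact: sqr_ge0.
have y0 i : y ord0 i ^+ 2 <= \sum_(i < m) y ord0 i ^+ 2.
  by rewrite (bigD1 i)//= lerDl sumr_ge0// => j _; exact: sqr_ge0.
split=> [|i].
  rewrite -(@ler_sqr R) ?nnegrE// real_normK ?num_real//.
  have : 0 <= \sum_(i < m) y ord0 i ^+ 2 by rewrite sumr_ge0// => j _; exact: sqr_ge0.
  by move: sq; lra.
rewrite /= in_itv /= -ler_norml -(@ler_sqr R) ?nnegrE ?sqrtr_ge0// real_normK ?num_real//.
have d0 : 0 <= rho ^+ 2 - a ^+ 2 by have := y0 i; move: sq (sqr_ge0 (y ord0 i)); lra.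
by have := y0 i; rewrite sqr_sqrtr//; move: sq; lra.
Qed.

(** The slice of the ball at first coordinate [a] lies in a cube of half-side [sqrt (rho ^+ 2 - a ^+
    2) <= sqrt 2 * sqrt rho * sqrt (rho - a)]. Write [expR (lam * a)] as [expR (lam * rho) * expR (-
    lam * (rho - a))]: one half of this decay away from the pole absorbs [sqrt (rho - a) ^ m], the
    other half makes the integral over [a] bounded. Only [sqrt rho ^ m] survives, and not the full
    power [rho ^ m]; this is the exponent [(n - 1) / 2]. *)
Lemma ball_volume (lam : R) : 0 < lam -> exists2 C : R, 0 < C &
  forall rho : R, 0 < rho ->
  (\int[lebn]_x (expR (lam * coord ord0 x) * \1_(open_ball rho) x)%:E <=
   (C * expR (lam * rho) * Num.sqrt rho ^+ m)%:E)%E.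
Proof.
move=> lam0; have lam2 : 0 < lam / 2 by rewrite divr_gt0.
have [K K0 hK] := sqrt_expr_le lam2.
pose C0 : R := 2 ^+ m * Num.sqrt 2 ^+ m * K.
have C00 : 0 <= C0 by rewrite !mulr_ge0 ?exprn_ge0 ?sqrtr_ge0.
(* The [+ 1] only secures strict positivity, as [K] is merely nonnegative. *)
exists (C0 / (lam / 2) + 1); first by rewrite ltr_wpDl// divr_ge0// ltW.
move=> rho rho0.
have mf : measurable_fun setT (fun x : space => (expR (lam * coord ord0 x) * \1_(open_ball rho) x)%:E).
  apply/measurable_EFinP; apply: measurable_funM.
    exact: smooth_gen_measurable (smooth_gen_coord ord0 (smooth_gen_expR lam)).
  by apply: measurable_indic; exact: measurable_open_ball.
have f0 (x : space) : (0 <= (expR (lam * coord ord0 x) * \1_(open_ball rho) x)%:E)%E.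
  by rewrite lee_fin mulr_ge0 ?expR_ge0.
rewrite integral_lebesgue_rVS//.
pose c := C0 * Num.sqrt rho ^+ m * expR (lam / 2 * rho).
have c0 : 0 <= c by rewrite !mulr_ge0 ?expR_ge0 ?exprn_ge0 ?sqrtr_ge0.
apply: (@le_trans _ _ (\int[leb1]_(a in `[(- rho)%R, rho]) (c * expR (lam / 2 * a))%:E)%E); last first.
  apply: le_trans (integral_expR_itv c0 lam2 rho0) _; rewrite lee_fin.
  have -> : c / (lam / 2) * expR (lam / 2 * rho) = C0 / (lam / 2) * expR (lam * rho) * Num.sqrt rho ^+ m.
    have -> : expR (lam * rho) = expR (lam / 2 * rho) * expR (lam / 2 * rho).
      by rewrite -expRD; congr expR; field.
    by rewrite /c; ring.
  by rewrite ler_wpM2r ?exprn_ge0 ?sqrtr_ge0// ler_wpM2r ?expR_ge0// lerDl.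
rewrite [leRHS]integral_mkcond; apply: ge0_le_integral => //.
- by move=> a _; apply: integral_ge0.
- apply: (@measurable_fun_fubini_tonelli_F _ _ _ _ _ lebm
    ((fun x : space => (expR (lam * coord ord0 x) * \1_(open_ball rho) x)%:E) \o @rV_cons R m)); last by move=> z; exact: f0.
  by apply: measurableT_comp => //; exact: measurable_rV_cons.
- apply/(measurable_restrictT _ _).1 => //; apply/measurable_EFinP.
  apply: measurable_funTS; apply: measurable_funM; first exact: measurable_cst.
  by apply: continuous_measurable_fun => a; exact: is_derive_continuous (is_derive_expR_comp (is_derive_mulc (lam / 2) (is_derive_id a 1))).
move=> a _; rewrite patchE; case: ifPn => [|/negP aI]; last first.
  rewrite integral0_eq// => y _; rewrite indicE memNset ?mulr0// => /ball_section[ar _].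
  by apply: aI; rewrite inE /= in_itv /= -ler_norml.
rewrite inE /= in_itv /= => aI; have [a1 a2] := andP aI.
set r := Num.sqrt (rho ^+ 2 - a ^+ 2).
pose B := [set y : 'rV[R]_m | forall i, `[- r, r]%classic (y ord0 i)].
have mB : measurable B.
  rewrite (_ : B = \bigcap_(i in [set: 'I_m]) ((fun y : 'rV[R]_m => y ord0 i) @^-1` `[-r, r]%classic)).
    apply: fin_bigcap_measurable => // i _; rewrite -[X in measurable X]setTI.
    by apply: measurable_rV_coord.
  by apply/seteqP; split=> x hx i; [move=> _; exact: hx|exact: hx].
have r0 : 0 <= r by exact: sqrtr_ge0.
have lB : (lebm B = ((2 * r) ^+ m)%:E)%E.
  rewrite (@lebesgue_rV_box R m (fun=> `[-r, r]%classic))//.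
  rewrite (eq_bigr (fun=> (2 * r)%:E)) => [|i _].
    by rewrite prodEFin prodr_const card_ord.
  rewrite lebesgue_measure_itv /= lte_fin; case: ifPn => [_|].
    by rewrite -EFinB; congr EFin; ring.
  by rewrite -leNgt => h; congr EFin; lra.
apply: (@le_trans _ _ (\int[lebm]_y ((expR (lam * a))%:E * (\1_B y)%:E))%E).
  apply: ge0_le_integral => //.
  - apply: measurableT_comp mf _; apply: measurableT_comp; first exact: measurable_rV_cons.
    exact: measurable_pair1.
  - by apply: measurable_funeM; apply/measurable_EFinP; exact: measurable_indic.
  - move=> y _; rewrite -EFinM lee_fin /coord rV_cons0 /= ler_wpM2l ?expR_ge0// !indicE.
    have [|_] := boolP (rV_cons (a, y) \in _); last by [].
    by rewrite inE => /ball_section[_ yB]; rewrite mem_set.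
rewrite ge0_integralZl_EFin ?expR_ge0//; last first.
  by apply/measurable_EFinP; exact: measurable_indic.
have -> : (\int[lebm]_x (\1_B x)%:E = ((2 * r) ^+ m)%:E)%E.
  by rewrite integral_indic// setIT; exact: lB.
rewrite -EFinM lee_fin.
have ra : 0 <= rho - a by lra.
have rle : r <= Num.sqrt 2 * Num.sqrt rho * Num.sqrt (rho - a).
  rewrite -!sqrtrM ?mulr_ge0// ?(ltW rho0)// ler_sqrt; last by rewrite !mulr_ge0// ltW.
  nra.
have rm : r ^+ m <= Num.sqrt 2 ^+ m * Num.sqrt rho ^+ m * (K * expR (lam / 2 * (rho - a))).
  apply: (@le_trans _ _ ((Num.sqrt 2 * Num.sqrt rho * Num.sqrt (rho - a)) ^+ m)).
    by rewrite lerXn2r// nnegrE !mulr_ge0 ?sqrtr_ge0.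
  by rewrite !exprMn ler_wpM2l ?hK// mulr_ge0 ?exprn_ge0 ?sqrtr_ge0.
rewrite exprMn; apply: (@le_trans _ _ (expR (lam * a) * (2 ^+ m *
  (Num.sqrt 2 ^+ m * Num.sqrt rho ^+ m * (K * expR (lam / 2 * (rho - a))))))).
  by rewrite ler_wpM2l ?expR_ge0// ler_wpM2l ?exprn_ge0.
have -> : expR (lam * a) = expR (lam / 2 * a) * expR (lam / 2 * a).
  by rewrite -expRD; congr expR; field.
have e1 : expR (lam / 2 * (rho - a)) * expR (lam / 2 * a) = expR (lam / 2 * rho).
  by rewrite -expRD; congr expR; ring.
rewrite /c /C0 -e1 le_eqVlt; apply/orP; left; apply/eqP; ring.
Qed.

End ball_volume.

Section cutoff_pairing.
Variables (R : realType) (m : nat).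
Local Notation space := 'rV[R]_m.+1.
Local Notation lebn := (lebesgue_rV R m.+1).

Lemma smooth_gen_L2 (f : space -> R) (r : R) : smooth_gen (@space_functional R m) f ->
  (forall y, ~ box (r + 1) y -> f y = 0) -> f \in Lfun lebn 2%:E.
Proof.
move=> hf f0; have [C hC] := bounded_smooth_gen hf f0.
apply: (@L2_bounded _ _ _ lebn (box (r + 1)) C) => //; first exact: measurable_box.
  exact: lebesgue_box_lty.
exact: smooth_gen_measurable.
Qed.

Lemma plane_cutoff_L2 (lam r : R) : @plane_cutoff R m lam r \in Lfun lebn 2%:E.
Proof.
apply: (@smooth_gen_L2 _ r); first exact: smooth_gen_plane_cutoff.
by move=> y; exact: plane_cutoff_eq0.
Qed.

Lemma Rintegral_sum_ord (k : nat) (f : 'I_k -> space -> R) :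
  (forall i, lebn.-integrable setT (EFin \o f i)) ->
  \int[lebn]_x (\sum_(i < k) f i x) = \sum_(i < k) \int[lebn]_x f i x.
Proof.
move=> hf; elim: (index_enum _) => [|i s IH].
  rewrite big_nil; under eq_Rintegral do rewrite big_nil.
  by rewrite Rintegral_cst ?mul0r.
rewrite big_cons -IH; under eq_Rintegral do rewrite big_cons.
rewrite RintegralD//.
rewrite (_ : EFin \o _ = (fun x => \sum_(i <- s) (EFin \o f i) x)%E).
  exact: integrable_sum.
by apply/funext => x; rewrite /= sumEFin.
Qed.

(** The weak gradient is tested with the first derivatives of the wave, which are test functions
    themselves. The resulting second derivatives are paired with [f], which vanishes off an open
    ball inside the box where the Laplacian is [lam ^+ 2] times the wave. *)
Lemma weak_gradient_plane_cutoff (a lam r rho : R) (f : space -> R) :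
  H1 f -> rho <= r -> {ae lebn, forall x, ~ open_ball rho x -> f x = 0} ->
  \int[lebn]_x (\sum_(i < m.+1)
      weak_gradient f i x * (a * 'D_(basis_vec R i) (plane_cutoff lam r) x)) =
  - (a * lam ^+ 2) * \int[lebn]_x (f x * plane_cutoff lam r x).
Proof.
move=> [f2 [G0 hG0]] rr fae; set psi := plane_cutoff lam r.
have hG : is_weak_gradient f (weak_gradient f).
  exact: (xgetPex (fun _ _ => 0) (ex_intro _ G0 hG0)).
have psig : smooth_gen (@space_functional R m) psi by exact: smooth_gen_plane_cutoff.
have psi0 y : ~ box (r + 1) y -> psi y = 0 by exact: plane_cutoff_eq0.
have dg v : smooth_gen (@space_functional R m) ('D_v psi) by exact: smooth_gen_derive_coord.
have d0 v y : ~ box (r + 1) y -> 'D_v psi y = 0.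
  by move=> by_; exact: (derive_eq0_outside _ by_).
have ddg v w : smooth_gen (@space_functional R m) ('D_v ('D_w psi)) by exact: smooth_gen_derive_coord.
have dd0 v w y : ~ box (r + 1) y -> 'D_v ('D_w psi) y = 0.
  by move=> by_; apply: (derive_eq0_outside _ by_) => z; exact: d0.
have igd i : lebn.-integrable setT
    (EFin \o (fun x => weak_gradient f i x * 'D_(basis_vec R i) psi x)).
  by apply: L2_integrable_mul; [exact: (hG i).1|exact: smooth_gen_L2 (dg _) (d0 _)].
under eq_Rintegral do under eq_bigr do rewrite mulrCA.
rewrite Rintegral_sum_ord => [|i]; last exact: EFin_integrableZ.
have step i : \int[lebn]_x (a * (weak_gradient f i x * 'D_(basis_vec R i) psi x)) =
    - (a * \int[lebn]_x (f x * 'D_(basis_vec R i) ('D_(basis_vec R i) psi) x)).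
  rewrite RintegralZl// -mulrN (hG i).2 ?opprK//.
  exact: test_function_smooth_gen (dg _) (d0 _).
rewrite (eq_bigr _ (fun i _ => step i)) sumrN -mulr_sumr mulNr -mulrA; congr (- (_ * _)).
have mf := L2_measurable f2.
have stepi i : \int[lebn]_x (f x * 'D_(basis_vec R i) ('D_(basis_vec R i) psi) x) =
    (if i == ord0 then lam ^+ 2 else 0) * \int[lebn]_x (f x * psi x).
  rewrite -RintegralZl//; last by apply: L2_integrable_mul => //; exact: plane_cutoff_L2.
  apply: Rintegral_ae_eq.
  - by apply: measurable_funM => //; exact: smooth_gen_measurable.
  - apply: measurable_funM => //; apply: measurable_funM => //.
    exact: smooth_gen_measurable.
  apply: filterS fae => x fx.
  have [bx|bx] := pselect (open_ball rho x); last by rewrite fx// !mul0r mulr0.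
  rewrite derive2_plane_cutoff => [|j].
    by case: ifP => _; rewrite ?mul0r ?mulr0// mulrCA.
  by apply: le_lt_trans (coord_le_euclidean_norm x j) _; exact: lt_le_trans bx rr.
rewrite (eq_bigr _ (fun i _ => stepi i)) -mulr_suml; congr (_ * _).
by rewrite (bigD1 ord0)//= big1 ?addr0// => i /negbTE ->.
Qed.

End cutoff_pairing.

(** * Pairings of an energy solution with a fixed function *)

Section energy_pairing.
Variables (R : realType) (m : nat) (p mu nu rad eps : R) (u0 u1 : 'rV[R]_m.+1 -> R).
Local Notation space := 'rV[R]_m.+1.
Local Notation lebn := (lebesgue_rV R m.+1).
Variables (T : \bar R) (u ut : R -> space -> R).
Hypothesis sol : energy_solution_with p mu nu rad eps u0 u1 T u ut.

Let u_L2 t : time_itv T t -> u t \in Lfun lebn 2%:E.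
Proof. by move=> /(energy_H1 sol)[]. Qed.

Lemma pairing_ut_cvg g t : g \in Lfun lebn 2%:E -> time_itv T t ->
  \int[lebn]_x (ut s x * g x) @[s --> within (time_itv T) (nbhs t)]
    --> \int[lebn]_x (ut t x * g x).
Proof.
move=> hg ht; apply/subr_cvg0.
apply: (cvg_trans _ (L2_pairing_cvg _ _ hg (energy_L2_cont sol ht))).
  apply: near_eq_cvg; near=> s.
  have hs : time_itv T s by near: s; exact: withinT.
  rewrite -RintegralB//; [|apply: L2_integrable_mul => //; exact: energy_L2 sol _ _..].
  by apply: eq_Rintegral => x _; rewrite mulrBl.
near=> s; have hs : time_itv T s by near: s; exact: withinT.
by apply: L2B; exact: energy_L2 sol _ _.
Unshelve. all: by end_near. Qed.

Lemma pairing_u_quotient_cvg g t : g \in Lfun lebn 2%:E -> time_itv T t ->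
  (\int[lebn]_x (u s x * g x) - \int[lebn]_x (u t x * g x)) / (s - t)
    @[s --> within (time_itv T `\ t) (nbhs t)] --> \int[lebn]_x (ut t x * g x).
Proof.
move=> hg ht; apply/subr_cvg0.
apply: (cvg_trans _ (L2_pairing_cvg _ _ hg (energy_deriv sol ht))).
  apply: near_eq_cvg; near=> s.
  have [hs _] : (time_itv T `\ t) s by near: s; exact: withinT.
  have iu r : time_itv T r -> lebn.-integrable setT (EFin \o (fun x => u r x * g x)).
    by move=> hr; apply: L2_integrable_mul => //; exact: u_L2.
  have iut : lebn.-integrable setT (EFin \o (fun x => ut t x * g x)).
    by apply: L2_integrable_mul => //; exact: energy_L2 sol _ _.
  transitivity (\int[lebn]_x ((s - t)^-1 * (u s x * g x - u t x * g x) - ut t x * g x)).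
    by apply: eq_Rintegral => x _; ring.
  have iB : lebn.-integrable setT (EFin \o (fun x => u s x * g x - u t x * g x)).
    by apply: EFin_integrableB => //; exact: iu.
  rewrite RintegralB//; last first.
    exact: EFin_integrableZ.
  by rewrite RintegralZl// RintegralB//; [rewrite mulrC|exact: iu..].
near=> s; have [hs _] : (time_itv T `\ t) s by near: s; exact: withinT.
apply: L2B; last exact: energy_L2 sol _ _.
rewrite (_ : (fun x => _) = fun x => (s - t)^-1 * (u s x - u t x)).
  by apply: L2Z; apply: L2B; exact: u_L2.
by apply/funext => x; rewrite mulrC.
Unshelve. all: by end_near. Qed.


(** At [t = 0] only the one-sided quotient converges; hence a derivative at interior times, and
    continuity on the closed interval proved apart. *)
Lemma pairing_u_derive g t : g \in Lfun lebn 2%:E -> 0 < t -> (t%:E < T)%E ->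
  is_derive t (1 : R) (fun s => \int[lebn]_x (u s x * g x)) (\int[lebn]_x (ut t x * g x)).
Proof.
move=> hg t0 tT; have ht : time_itv T t by split=> //; exact: ltW.
set F := fun s => \int[lebn]_x (u s x * g x); set l := \int[lebn]_x (ut t x * g x).
have h : h^-1 *: ((F \o shift t) (h *: 1) - F t) @[h --> 0^'] --> l.
  apply/cvgrPdist_lt => e e0.
  have /cvgrPdist_lt/(_ _ e0) := pairing_u_quotient_cvg hg ht.
  rewrite /within /= -!nbhs_nearE => /nbhs_ballP[d /= d0 hd].
  have [b tb bT] : exists2 b : R, t < b & (b%:E <= T)%E.
    case: (T) tT => [r|_|//]; last by exists (t + 1) => //; rewrite ?leey//; lra.
    by rewrite lte_fin => tr; exists r.
  apply/nbhs_ballP; exists (Num.min d (Num.min t (b - t))).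
    by rewrite /= !lt_min d0 t0 subr_gt0.
  move=> k; rewrite /ball /= sub0r normrN !lt_min => /andP[kd /andP[kt kb]] k0.
  have := hd (k + t); rewrite /ball /= opprD addrCA subrr addr0 normrN => /(_ kd).
  rewrite /= /F addrK /GRing.scale /= mulr1 mulrC; apply; split.
    move: kt kb; rewrite !ltr_norml => /andP[k1 _] /andP[_ k2]; split; first by lra.
    by apply: lt_le_trans bT; rewrite lte_fin; lra.
  by move=> /eqP; rewrite -subr_eq0 addrK; apply/negP.
split; first by apply/cvg_ex; exists l.
exact: cvg_lim h.
Qed.

(** Near [t] the difference quotients are bounded by [|l| + 1], which gives a Lipschitz estimate at
    [t]. This covers the endpoint 0 and avoids a comparison of [H1norm] with [L2norm]. *)
Lemma pairing_u_continuous g (b : R) : g \in Lfun lebn 2%:E -> (b%:E < T)%E ->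
  {within `[0, b], continuous (fun s => \int[lebn]_x (u s x * g x))}.
Proof.
move=> hg bT; apply/subspace_continuousP => t; rewrite /= in_itv /= => /andP[t0 tb].
have ht : time_itv T t by split=> //; apply: le_lt_trans bT; rewrite lee_fin.
set F := fun s => \int[lebn]_x (u s x * g x).
apply/cvgrPdist_lt => e e0.
have := pairing_u_quotient_cvg hg ht; set l := \int[lebn]_x (ut t x * g x).
move=> /cvgrPdist_lt/(_ _ ltr01); rewrite /within /= -!nbhs_nearE => /nbhs_ballP[d /= d0 hd].
have l1 : 0 < `|l| + 1 by rewrite ltr_wpDl.
apply/nbhs_ballP; exists (Num.min d (e / (`|l| + 1))).
  by rewrite /= lt_min d0 divr_gt0.
move=> s; rewrite /ball /= lt_min => /andP[sd se]; rewrite in_itv /= => /andP[s0 sb].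
have [->|st] := eqVneq s t; first by rewrite subrr normr0.
have := hd _ sd; rewrite -/F => /(_ _)/wrap[].
  split; last by move=> /eqP; rewrite (negbTE st).
  by split=> //; apply: le_lt_trans bT; rewrite lee_fin.
move=> hq; have : `|(F s - F t) / (s - t)| < `|l| + 1.
  rewrite (_ : (F s - F t) / (s - t) = l - (l - (F s - F t) / (s - t))); last by ring.
  by apply: le_lt_trans (ler_normB _ _) _; rewrite ltrD2l.
have st0 : 0 < `|s - t| by rewrite normr_gt0 subr_eq0.
rewrite normf_div ltr_pdivrMr// distrC => hh; apply: lt_trans hh _.
by rewrite mulrC -ltr_pdivlMr// distrC.
Qed.

Lemma pairing_ut_continuous g (b : R) : g \in Lfun lebn 2%:E -> (b%:E < T)%E ->
  {within `[0, b], continuous (fun s => \int[lebn]_x (ut s x * g x))}.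
Proof.
move=> hg bT; apply/subspace_continuousP => t; rewrite /= in_itv /= => /andP[t0 tb].
have ht : time_itv T t by split=> //; apply: le_lt_trans bT; rewrite lee_fin.
apply: cvg_trans (pairing_ut_cvg hg ht); apply: cvg_fmap2 => A; rewrite /within /=.
apply: filterS => s h; rewrite in_itv /= => /andP[s0 sb]; apply: h; split=> //.
by apply: le_lt_trans bT; rewrite lee_fin.
Qed.

Lemma u_eq0_off_ball t : time_itv T t ->
  {ae lebn, forall x, ~ open_ball (rad + t) x -> u t x = 0}.
Proof. by move=> ht; apply: ae_eq0_off_support; exact: energy_support sol _ ht. Qed.

Lemma pairing_u_off_ball g t r : g \in Lfun lebn 2%:E -> time_itv T t -> rad + t <= r ->
  (forall x, open_ball r x -> g x = 0) -> \int[lebn]_x (u t x * g x) = 0.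
Proof.
move=> hg ht tr g0.
rewrite (@Rintegral_ae_eq _ _ _ lebn _ (cst 0)) ?Rintegral_cst ?mul0r//.
  exact: measurable_funM (L2_measurable (u_L2 ht)) (L2_measurable hg).
apply: filterS (u_eq0_off_ball ht) => x hx.
have [bx|bx] := pselect (open_ball (rad + t) x); last by rewrite hx// mul0r.
by rewrite g0 ?mulr0//; exact: lt_le_trans bx tr.
Qed.

(* Off the ball of radius [rad + t + h] all the difference quotients of [u] at [t]
   with increment less than [h] vanish. *)
Lemma pairing_ut_off_ball g t h : g \in Lfun lebn 2%:E -> time_itv T t -> 0 < h ->
  (forall x, open_ball (rad + t + h) x -> g x = 0) -> \int[lebn]_x (ut t x * g x) = 0.
Proof.
move=> hg ht h0 g0; set l := LHS; apply/eqP; rewrite -normr_eq0.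
rewrite -(negbK (_ == 0)); apply/negP => ln0.
have e0 : 0 < `|l| by rewrite lt_neqAle eq_sym ln0 normr_ge0.
have /cvgrPdist_lt/(_ _ e0) := pairing_u_quotient_cvg hg ht.
rewrite /within -!nbhs_nearE => /nbhs_ballP[d d0' hd].
have d0 : 0 < d := d0'.
have [t0 tT] := ht.
have [b tb bT] : exists2 b : R, t < b & (b%:E <= T)%E.
  case: (T) tT => [r|_|//]; last by exists (t + 1) => //; rewrite ?leey//; lra.
  by rewrite lte_fin => tr; exists r.
pose k := Num.min (Num.min d h) (b - t) / 2.
have m0 : 0 < Num.min (Num.min d h) (b - t) by rewrite !lt_min d0 h0 subr_gt0.
have k0 : 0 < k by rewrite divr_gt0.
have : k < Num.min (Num.min d h) (b - t) by rewrite /k; lra.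
rewrite !lt_min => /andP[/andP[kd kh] kb].
have hs : time_itv T (t + k).
  split; first by lra.
  by apply: lt_le_trans bT; rewrite lte_fin; lra.
have tk : t + k <> t by move=> /eqP; rewrite -subr_eq0 addrAC subrr add0r gt_eqF.
have bk : ball t d (t + k) by rewrite /ball /= opprD addrA subrr add0r normrN gtr0_norm.
have := hd _ bk (conj hs tk).
rewrite -/l (pairing_u_off_ball hg hs _ g0); last by lra.
rewrite (pairing_u_off_ball hg ht _ g0); last by lra.
by rewrite subrr mul0r subr0 ltxx.
Qed.

End energy_pairing.

(** * The nonlinear term *)

Section jensen.
Variables (R : realType).

(** The graph of the power lies above its tangent at [A]; this is Young's inequality for the
    conjugate exponents [p] and [p / (p - 1)]. *)
Lemma powR_tangent_le (p y A : R) : 1 < p -> 0 <= y -> 0 <= A ->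
  p * (A `^ (p - 1) * y) <= y `^ p + (p - 1) * A `^ p.
Proof.
move=> p1 y0 A0; have p0 : 0 < p by lra.
have q0 : 0 < p / (p - 1) by rewrite divr_gt0// subr_gt0.
have pn : p != 0 by rewrite gt_eqF.
have p1n : p - 1 != 0 by rewrite gt_eqF// subr_gt0.
have := @conjugate_powR R y (A `^ (p - 1)) p (p / (p - 1)) y0 (powR_ge0 _ _) p0 q0.
rewrite -powRrM (_ : (p - 1) * (p / (p - 1)) = p); last by field.
move=> /(_ _)/wrap[]; first by rewrite invf_div; field.
move=> h; have := ler_wpM2l (ltW p0) h.
rewrite mulrDr (_ : p * (y `^ p / p) = y `^ p); last by field.
rewrite (_ : p * (A `^ p / (p / (p - 1))) = (p - 1) * A `^ p); last by rewrite invf_div; field.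
by rewrite [y * _]mulrC.
Qed.

Context d (X : measurableType d) (nu : {measure set X -> \bar R}).

(** The tangent inequality at the mean value [A = g / V] is integrated against [w]. As [g = A * V],
    the left side minus the constant term is [A ^ (p - 1) * g = V ^ (1 - p) * g ^ p]. An upper bound
    [V] for the mass of [w] suffices, and the right-hand side may be infinite. *)
Lemma jensen_pairing (p V : R) (f w : X -> R) : 1 < p -> 0 < V ->
  measurable_fun setT f -> measurable_fun setT w -> (forall x, 0 <= w x) ->
  nu.-integrable setT (EFin \o (fun x => f x * w x)) ->
  (\int[nu]_x (w x)%:E <= V%:E)%E ->
  ((V `^ (1 - p) * `|\int[nu]_x (f x * w x)| `^ p)%:E <=
   \int[nu]_x (`|f x| `^ p * w x)%:E)%E.
Proof.
move=> p1 V0 mf mw w0 ifw wV; set g : R := `| _ |.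
have p0 : 0 < p by lra.
have mfp : measurable_fun setT (fun x => `|f x| `^ p * w x).
  apply: measurable_funM => //; apply: (measurableT_comp (measurable_powR _)).
  exact: measurableT_comp.
have [g0|g0] := eqVneq g 0.
  rewrite g0 powR0 ?gt_eqF// mulr0 integral_ge0// => x _.
  by rewrite lee_fin mulr_ge0// powR_ge0.
have {}g0 : 0 < g by rewrite lt_neqAle eq_sym g0 normr_ge0.
pose A : R := g / V; have A0 : 0 < A by rewrite divr_gt0.
have h1 : ((p * A `^ (p - 1) * g)%:E <=
    \int[nu]_x (`|f x| `^ p * w x)%:E + ((p - 1) * A `^ p * V)%:E)%E.
  apply: (@le_trans _ _ ((p * A `^ (p - 1))%:E * \int[nu]_x `|f x * w x|%:E)%E).
    rewrite EFinM lee_wpmul2l ?lee_fin ?mulr_ge0 ?powR_ge0 ?(ltW p0)//.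
    rewrite /g EFin_normr_Rintegral//; apply: le_abse_integral => //.
    exact: measurable_int ifw.
  rewrite -ge0_integralZl_EFin ?mulr_ge0 ?powR_ge0 ?(ltW p0)//; last first.
    by apply/measurable_EFinP; apply: measurableT_comp => //; exact: measurable_funM.
  apply: (@le_trans _ _ (\int[nu]_x ((`|f x| `^ p * w x)%:E + (((p - 1) * A `^ p)%:E * (w x)%:E)))%E).
    apply: ge0_le_integral => //.
    - by move=> x _; rewrite -EFinM lee_fin !mulr_ge0 ?powR_ge0 ?(ltW p0).
    - apply: measurable_funeM; apply/measurable_EFinP; apply: measurableT_comp => //.
      exact: measurable_funM.
    - apply: emeasurable_funD; first exact/measurable_EFinP.
      by apply: measurable_funeM; exact/measurable_EFinP.
    - move=> x _; rewrite -!EFinM -EFinD lee_fin normrM (ger0_norm (w0 x)).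
      rewrite (_ : _ * (_ * w x) = p * (A `^ (p - 1) * `|f x|) * w x); last by ring.
      by rewrite -mulrDl ler_wpM2r// powR_tangent_le// ltW.
  rewrite ge0_integralD//; last 4 first.
  - by move=> x _; rewrite lee_fin mulr_ge0// powR_ge0.
  - exact/measurable_EFinP.
  - by move=> x _; rewrite -EFinM lee_fin !mulr_ge0 ?powR_ge0// subr_ge0 ltW.
  - by apply: measurable_funeM; exact/measurable_EFinP.
  rewrite leeD2l// ge0_integralZl_EFin ?mulr_ge0 ?powR_ge0 ?subr_ge0 ?(ltW p1)//; last 2 first.
  - by move=> x _; rewrite lee_fin.
  - exact/measurable_EFinP.
  by rewrite [leRHS]EFinM lee_wpmul2l// lee_fin mulr_ge0 ?powR_ge0// subr_ge0 ltW.
rewrite -leeBlDr// -EFinB in h1; apply: le_trans h1; rewrite lee_fin.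
have AE : A `^ p = A `^ (p - 1) * A.
  by rewrite mulrC mulr_powRB1// ltW.
have -> : p * A `^ (p - 1) * g - (p - 1) * A `^ p * V = A `^ (p - 1) * g.
  have -> : g = A * V by rewrite /A divfK// gt_eqF.
  by rewrite AE; ring.
rewrite /A powRM ?invr_ge0 ?(ltW g0) ?(ltW V0)// -powR_inv1 ?(ltW V0)// -powRrM mulN1r opprB.
by rewrite -(mulr_powRB1 (ltW g0) p0) le_eqVlt; apply/orP; left; apply/eqP; ring.
Qed.

End jensen.

Section nonlinear_term.
Variables (R : realType) (m : nat) (p : R) (T : \bar R).
Local Notation space := 'rV[R]_m.+1.
Local Notation lebn := (lebesgue_rV R m.+1).
Local Notation leb1 := (@lebesgue_measure R).
Variables (v : R -> space -> R) (t : R) (r : R) (e : R -> R) (psi : space -> R).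
Hypotheses (t0 : 0 <= t) (Lpv : Lp_loc p T v) (tT : (t%:E < T)%E) (ce : continuous e) (e0 : forall s, 0 <= e s)
  (psig : smooth_gen (@space_functional R m) psi) (psi_ge0 : forall x, 0 <= psi x)
  (psi0 : forall x, ~ box (r + 1) x -> psi x = 0).

Lemma measurable_time_itv : measurable (time_itv T).
Proof.
case: T => [b||].
- rewrite (_ : time_itv _ = `[0, b[%classic)//.
  apply/funext => s; apply/propext; rewrite /time_itv /= in_itv /= lte_fin.
  by split=> [[-> ->]//|/andP[]].
- rewrite (_ : time_itv _ = `[0, +oo[%classic)//.
  apply/funext => s; apply/propext; rewrite /time_itv /= in_itv /= ltry andbT.
  by split=> [[]|].
- rewrite (_ : time_itv _ = set0)//.
  by apply/seteqP; split=> s // -[_]; rewrite ltNge leNye.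
Qed.

Let D : set (measurableTypeR R * space) := `[0, t]%classic `*` setT.

Let mD : measurable D.
Proof. by apply: measurableX => //; exact: measurable_itv. Qed.

Let f (z : measurableTypeR R * space) : \bar R :=
  (`|v z.1 z.2| `^ p * (e z.1 * psi z.2))%:E.

Let h := f \_ D.

Let mfD : measurable_fun D f.
Proof.
apply/measurable_EFinP; apply: measurable_funM.
  apply: (measurableT_comp (measurable_powR _)); apply: measurableT_comp => //.
  apply: measurable_funS Lpv.1; first by apply: measurableX => //; exact: measurable_time_itv.
  move=> [s x] [/= + _]; rewrite in_itv /= => /andP[s0 st]; split=> //; split=> //=.
  by apply: le_lt_trans tT; rewrite lee_fin.
apply: measurable_funTS; apply: measurable_funM.
  by apply: measurableT_comp => //; exact: continuous_measurable_fun.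
by apply: measurableT_comp => //; exact: smooth_gen_measurable.
Qed.

Let mh : measurable_fun setT h.
Proof. exact/(measurable_restrictT _ _).1. Qed.

Let h0 z : (0 <= h z)%E.
Proof.
rewrite /h patchE; case: ifP => // _.
by rewrite lee_fin !mulr_ge0 ?powR_ge0.
Qed.

Let h_lty : (\int[leb1 \x lebn]_z h z < +oo)%E.
Proof.
have [C hC] := bounded_smooth_gen psig psi0.
have [C' hC'] : exists C', forall s, 0 <= s <= t -> e s <= C'.
  have ce' : {within `[0, t], continuous e} by exact: continuous_subspaceT.
  have [M [_ hM]] := compact_bounded (continuous_compact ce' (@segment_compact _ 0 t)).
  exists (`|M| + 1) => s st; apply: le_trans (ler_norm _) _.
  apply: (hM (`|M| + 1)); first by rewrite ltr_pwDr// ler_norm.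
  by exists s.
pose K : set (measurableTypeR R * space) := `[0, t]%classic `*` box (r + 1).
have mK : measurable K by apply: measurableX; [exact: measurable_itv|exact: measurable_box].
have mKv : measurable_fun K (fun z => (`|v z.1 z.2| `^ p)%:E).
  apply/measurable_EFinP; apply: (measurableT_comp (measurable_powR _)).
  apply: measurableT_comp => //; apply: measurable_funS Lpv.1.
    by apply: measurableX => //; exact: measurable_time_itv.
  move=> [s x] [/= + _]; rewrite in_itv /= => /andP[s0 st]; split=> //; split=> //=.
  by apply: le_lt_trans tT; rewrite lee_fin.
have Kfin : (\int[leb1 \x lebn]_(z in K) (`|v z.1 z.2| `^ p)%:E < +oo)%E.
  apply: Lpv.2; first by apply: compact_setX; [exact: segment_compact|exact: compact_box].
  move=> [s x] [/= + _]; rewrite in_itv /= => /andP[s0 st]; split=> //; split=> //=.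
  by apply: le_lt_trans tT; rewrite lee_fin.
have C'0 : 0 <= C' by apply: le_trans (e0 0) (hC' 0 _); rewrite lexx t0.
have C0 : 0 <= C by apply: le_trans (hC 0).
apply: (@le_lt_trans _ _ ((C' * C)%:E * \int[leb1 \x lebn]_(z in K) (`|v z.1 z.2| `^ p)%:E)%E); last first.
  by rewrite lte_mul_pinfty// ?lee_fin ?mulr_ge0.
rewrite -ge0_integralZl_EFin ?mulr_ge0//.
rewrite [leRHS]integral_mkcond; apply: ge0_le_integral => //.
- exact: ((measurable_restrictT _ mK).1 (measurable_funeM (C' * C)%:E mKv)).
move=> z _; rewrite /h !patchE; case: ifPn => [|_]; last first.
  by case: ifP => // _; rewrite -EFinM lee_fin !mulr_ge0 ?powR_ge0.
rewrite inE => -[z1 _]; case: ifPn => [_|/negP zK].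
  rewrite -EFinM lee_fin mulrC ler_wpM2r ?powR_ge0// ler_pM//.
    by apply: hC'; move: z1; rewrite /= in_itv.
  by apply: le_trans (hC z.2); exact: ler_norm.
rewrite /f psi0 ?mulr0// => bz; apply: zK; rewrite inE; split=> //.
Qed.


Let hE s : 0 <= s <= t ->
  (\int[lebn]_x h (s, x) = (e s)%:E * \int[lebn]_x (`|v s x| `^ p * psi x)%:E)%E.
Proof.
move=> st; have sD x : (s, x) \in D by rewrite inE /D; split=> //=; rewrite in_itv.
rewrite -ge0_integralZl_EFin//.
- by apply: eq_integral => x _; rewrite /h patchE sD /f /= -EFinM; congr EFin; ring.
- by move=> x _; rewrite lee_fin mulr_ge0 ?powR_ge0.
- apply/measurable_EFinP; apply: measurable_funM; last exact: smooth_gen_measurable.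
  have /andP[s0 st'] := st.
  apply: (measurableT_comp (measurable_powR _)); apply: measurableT_comp => //.
  have mE : measurable_fun setT (fun x : space => (s, x)).
    exact: measurable_pair1.
  rewrite (_ : v s = (fun z => v z.1 z.2) \o (fun x : space => (s, x)))//.
  apply: (measurable_comp _ _ Lpv.1) => //.
    by apply: measurableX => //; exact: measurable_time_itv.
  move=> _ [x _ <-] /=; split=> //; split=> //=.
  by apply: le_lt_trans tT; rewrite lee_fin.
Qed.

Let H (s : R) : \bar R := (\int[lebn]_x h (s, x))%E.

Let mH : measurable_fun setT H.
Proof. exact: (@measurable_fun_fubini_tonelli_F _ _ _ _ _ lebn h mh h0). Qed.

Let H0 s : (0 <= H s)%E.
Proof. by apply: integral_ge0 => x _; exact: h0. Qed.

Let iH : leb1.-integrable setT H.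
Proof.
apply/integrableP; split=> //.
rewrite [X in (X < _)%E](_ : _ = \int[leb1]_s H s)%E; last first.
  by apply: eq_integral => s _; rewrite gee0_abs.
by have := h_lty; rewrite fubini_tonelli1.
Qed.

(** The weak identity uses real-valued integrals, for which an infinite integral counts as 0 and a
    lower bound would be lost. [Lp_loc] on a compact set and Tonelli's theorem make the double
    integral finite, so the inner integral is infinite only for a null set of times, and there the
    default value does no harm. *)
Lemma nonlinear_term_ge (f0 : R -> R) :
  {within `[0, t], continuous f0} -> (forall s, 0 <= s <= t -> 0 <= f0 s) ->
  (forall s, 0 <= s <= t -> ((f0 s)%:E <= \int[lebn]_x (`|v s x| `^ p * psi x)%:E)%E) ->
  \int[leb1]_(s in `[0, t]) (e s * f0 s) <=
  \int[leb1]_(s in `[0, t]) \int[lebn]_x (`|v s x| `^ p * (e s * psi x)).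
Proof.
move=> cf f00 hf.
have cef : {within `[0, t], continuous (fun s => e s * f0 s)}.
  apply/subspace_continuousP => s st; apply: cvgM.
    by apply: cvg_within_filter; exact: ce.
  by have /subspace_continuousP := cf; exact.
have ief : leb1.-integrable `[0, t] (EFin \o (fun s => e s * f0 s)).
  by apply: continuous_compact_integrable => //; exact: segment_compact.
have RE s : 0 <= s <= t -> \int[lebn]_x (`|v s x| `^ p * (e s * psi x)) = fine (H s).
  move=> st; have sD x : (s, x) \in D by rewrite inE /D; split=> //=; rewrite in_itv.
  by congr fine; apply: eq_integral => x _; rewrite /h patchE sD.
have -> : \int[leb1]_(s in `[0, t]) \int[lebn]_x (`|v s x| `^ p * (e s * psi x)) =
    \int[leb1]_(s in `[0, t]) fine (H s).
  apply: eq_Rintegral => s; rewrite inE /= in_itv /= => st; exact: RE.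
have Hfin := integrable_ae measurableT iH.
have iH' : leb1.-integrable `[0, t] H by apply: integrableS iH.
have eqH : (\int[leb1]_(s in `[0%R, t]) (fine (H s))%:E = \int[leb1]_(s in `[0%R, t]) H s)%E.
  apply: ae_eq_integral => //.
  - have mfH : measurable_fun setT (fine \o H).
      exact: (measurableT_comp (fine_measurable measurableT) mH).
    by apply/measurable_EFinP; exact: (measurable_funS measurableT (@subsetT _ _) mfH).
  - exact: measurable_funTS.
  - by apply: filterS Hfin => s /(_ I) Hs _; rewrite fineK.
apply: fine_le.
- by apply: integrable_fin_num => //; exact: measurable_itv.
- by rewrite eqH; apply: integrable_fin_num => //; exact: measurable_itv.
rewrite eqH; apply: ge0_le_integral => //.
- by move=> s; rewrite /= in_itv /= => st; rewrite lee_fin mulr_ge0// f00.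
- exact: measurable_int ief.
- exact: measurable_funTS.
move=> s; rewrite /= in_itv /= => st; rewrite /H hE// EFinM lee_wpmul2l ?lee_fin//.
exact: hf.
Qed.

End nonlinear_term.

(** * The differential inequality of an energy solution *)

Section data.
Variables (R : realType) (m : nat) (lam rad : R).
Local Notation space := 'rV[R]_m.+1.
Local Notation lebn := (lebesgue_rV R m.+1).
Variable f : space -> R.
Hypotheses (f2 : f \in Lfun lebn 2%:E) (fsupp : ess_support f `<=` open_ball rad).

(** The cutoff radius will grow with the final time [b]; the size of the data, which enters the
    lifespan constant, must not. *)
Lemma data_pairing_cutoff r : rad <= r ->
  \int[lebn]_x (f x * plane_cutoff lam r x) = \int[lebn]_x (f x * plane_cutoff lam rad x).
Proof.
move=> rr; apply: Rintegral_ae_eq.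
- exact: measurable_funM (L2_measurable f2) (L2_measurable (plane_cutoff_L2 m lam _)).
- exact: measurable_funM (L2_measurable f2) (L2_measurable (plane_cutoff_L2 m lam _)).
apply: filterS (ae_eq0_off_support fsupp) => x fx.
have [bx|bx] := pselect (open_ball rad x); last by rewrite fx// !mul0r.
have xr := open_ball_box bx.
rewrite !plane_cutoffE// => i; exact: le_trans (xr i) rr.
Qed.

Hypothesis f0 : {ae lebn, forall x, 0 <= f x}.

Lemma data_pairing_norm r :
  \int[lebn]_x (f x * plane_cutoff lam r x) = \int[lebn]_x `|f x * plane_cutoff lam r x|.
Proof.
have mf := measurable_funM (L2_measurable f2) (L2_measurable (plane_cutoff_L2 m lam r)).
apply: Rintegral_ae_eq => //; first exact: measurableT_comp.
by apply: filterS f0 => x fx; rewrite ger0_norm// mulr_ge0// plane_cutoff_ge0.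
Qed.

Lemma data_pairing_ge0 r : 0 <= \int[lebn]_x (f x * plane_cutoff lam r x).
Proof. by rewrite data_pairing_norm; apply: Rintegral_ge0. Qed.

(** The wave is strictly positive on the ball and [f] vanishes off it. Contrapositively, data that
    do not both vanish have a strictly positive total pairing, the starting value of the blow-up. *)
Lemma data_pairing_eq0 : \int[lebn]_x (f x * plane_cutoff lam rad x) = 0 ->
  {ae lebn, forall x, f x = 0}.
Proof.
have psi2 := plane_cutoff_L2 m lam rad.
have ifp := L2_integrable_mul f2 psi2.
have mf := measurable_funM (L2_measurable f2) (L2_measurable psi2).
rewrite data_pairing_norm => h0.
have : (\int[lebn]_x `|(EFin \o (fun x => (f x * plane_cutoff lam rad x)%R)) x| = 0)%E.
  rewrite -[LHS]fineK; last first.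
    by apply: integrable_fin_num => //; exact: integrable_abse.
  by congr EFin; exact: h0.
move=> /(ae_eq_integral_abs lebn measurableT); have mE := measurable_int _ ifp.
move=> /(_ mE) h; apply: filterS2 h (ae_eq0_off_support fsupp) => x /= /(_ I)[hx] fx.
have [bx|/fx//] := pselect (open_ball rad x).
move/eqP: hx; rewrite mulf_eq0 => /orP[/eqP//|].
by rewrite plane_cutoffE ?gt_eqF ?expR_gt0//; exact: open_ball_box.
Qed.

End data.

Section energy_blowup.
Variables (R : realType) (m : nat) (p mu nu rad : R) (u0 u1 : 'rV[R]_m.+1 -> R).
Local Notation space := 'rV[R]_m.+1.
Local Notation lebn := (lebesgue_rV R m.+1).
Local Notation leb1 := (@lebesgue_measure R).
Variables (lam K : R).
Hypotheses (p1 : 1 < p) (mu0 : 0 <= mu) (lam0 : 0 < lam)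
  (lamE : lam ^+ 2 = nu ^+ 2 + 2 + mu) (K0 : 0 < K).
Let V (s : R) : R := K * expR (lam * s + m%:R / 2 * ln (1 + s)).
Hypothesis ball_V : forall s : R, 0 <= s ->
  (\int[lebn]_x (expR (lam * coord ord0 x) * \1_(open_ball (rad + s + 1)%R) x)%:E <= (V s)%:E)%E.
Hypotheses (hu0 : H1 u0) (hu1 : u1 \in Lfun lebn 2%:E)
  (su0 : ess_support u0 `<=` open_ball rad) (su1 : ess_support u1 `<=` open_ball rad).

Variables (eps : R) (T : \bar R) (u ut : R -> space -> R).
Hypothesis sol : energy_solution_with p mu nu rad eps u0 u1 T u ut.
Variable (b : R).
Hypotheses (b0 : 0 <= b) (bT : (b%:E < T)%E).
(** The extra 1 is the margin [h = 1] with which [pairing_ut_off_ball] is used at all times up to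
    [b]. *)
Let r := rad + b + 1.
Let psi := @plane_cutoff R m lam r.
Let F s := \int[lebn]_x (u s x * psi x).
Let G s := \int[lebn]_x (ut s x * psi x).
Let c (s : R) : R := K `^ (1 - p) * expR (- (p - 1) * (lam * s) - ((p - 1) * (m%:R / 2)) * ln (1 + s)).

Let psi2 : psi \in Lfun lebn 2%:E. Proof. exact: plane_cutoff_L2. Qed.

Let inT (s : R) : 0 <= s <= b -> time_itv T s.
Proof. by move=> /andP[s0 sb]; split=> //; apply: le_lt_trans bT; rewrite lee_fin. Qed.

Let cE s : c s = V s `^ (1 - p).
Proof.
rewrite /c /V powRM ?(ltW K0) ?expR_ge0// -expRM; congr (_ * expR _).
by ring.
Qed.

(** The mass of [psi] on its whole box would give too weak a constant at times [s < b]. Jensen's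
    inequality is applied to the restriction [w] of [psi] to the ball of radius [rad + s + 1], of
    mass at most [V s]. This leaves [G s] unchanged, since [psi - w] vanishes on that ball and
    [ut s] does not see the exterior. *)
Lemma nonlinear_pairing_ge (s : R) : 0 <= s <= b ->
  ((c s * `|G s| `^ p)%:E <= \int[lebn]_x (`|ut s x| `^ p * psi x)%:E)%E.
Proof.
move=> sb; have [s0 sb'] := andP sb; have hs := inT sb.
have ut2 := energy_L2 sol hs.
pose B : set space := open_ball (rad + s + 1).
pose w x := psi x * \1_B x.
have mB : measurable B by exact: measurable_open_ball.
have Br : B `<=` box r.
  move=> x /open_ball_box h i; apply: le_trans (h i) _; rewrite /r; lra.
have mw : measurable_fun setT w.
  by apply: measurable_funM; [exact: L2_measurable psi2|exact: measurable_indic].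
have w0 x : 0 <= w x by rewrite mulr_ge0// plane_cutoff_ge0.
have wpsi x : w x <= psi x.
  by rewrite /w indicE; case: (_ \in _); rewrite ?mulr1// mulr0 plane_cutoff_ge0.
have w2 : w \in Lfun lebn 2%:E.
  have [C hC] := bounded_smooth_gen (smooth_gen_plane_cutoff m lam r) (@plane_cutoff_eq0 R m lam r).
  apply: (@L2_bounded _ _ _ lebn (box (r + 1)) C) => //; first exact: measurable_box.
  - exact: lebesgue_box_lty.
  - by move=> x; rewrite ger0_norm//; apply: le_trans (wpsi x) (le_trans (ler_norm _) (hC x)).
  - by move=> x bx; rewrite /w /psi plane_cutoff_eq0 ?mul0r.
have -> : G s = \int[lebn]_x (ut s x * w x).
  apply/eqP; rewrite -subr_eq0 -RintegralB//; [|exact: L2_integrable_mul..].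
  rewrite (@eq_Rintegral _ _ _ lebn _ (fun x => ut s x * (psi x - w x))) => [|x _]; last by rewrite mulrBr.
  apply/eqP; apply: (pairing_ut_off_ball sol (L2B psi2 w2) hs ltr01) => x bx.
  by rewrite /w indicE mem_set// mulr1 subrr.
rewrite cE; apply: (@le_trans _ _ (\int[lebn]_x (`|ut s x| `^ p * w x)%:E)%E).
  apply: jensen_pairing => //.
  - by rewrite mulr_gt0 ?expR_gt0.
  - exact: L2_measurable ut2.
  - exact: L2_integrable_mul.
  - apply: le_trans (ball_V s0); rewrite le_eqVlt; apply/orP; left; apply/eqP.
    apply: eq_integral => x _; congr EFin; rewrite /w indicE -/B.
    have [|_] := boolP (x \in B); last by rewrite !mulr0.
    by rewrite inE => /Br bx; rewrite /psi plane_cutoffE.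
have mp : measurable_fun setT (fun x => `|ut s x| `^ p).
  apply: (measurableT_comp (measurable_powR _)); apply: measurableT_comp => //.
  exact: L2_measurable ut2.
apply: ge0_le_integral => //.
- by move=> x _; rewrite lee_fin mulr_ge0 ?powR_ge0.
- by apply/measurable_EFinP; exact: measurable_funM.
- by apply/measurable_EFinP; apply: measurable_funM => //; exact: L2_measurable psi2.
- by move=> x _; rewrite lee_fin ler_wpM2l ?powR_ge0.
Qed.

(** The weak identity for [expR (mu * s) * psi x], with all terms rewritten as time integrals of [F]
    and [G]. The nonlinear term alone is estimated, the rest is equality; the summand [mu * G s]
    comes from differentiating the time factor. *)
Lemma energy_inequality (t : R) : 0 <= t <= b ->
  G 0 + \int[leb1]_(s in `[0, t]) (expR (mu * s) *
    ((mu - mu * (1 + s)^-1) * G s + (lam ^+ 2 - nu ^+ 2 * (1 + s)^-1 ^+ 2) * F s +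
      c s * `|G s| `^ p)) <= expR (mu * t) * G t.
Proof.
move=> tb; have [t0 tb'] := andP tb.
(* Room for the time cutoff: it equals the exponential on [[0, b]] and vanishes from [b' < T] on. *)
have [b' bb' b'T] : exists2 b' : R, b < b' & (b'%:E < T)%E.
  move: bT; case: (T) => [x| |]//; last by exists (b + 1); rewrite ?ltry//; lra.
  by rewrite lte_fin => bx; exists ((b + x) / 2); rewrite ?lte_fin; lra.
have psig : smooth_gen (@space_functional R m) psi by exact: smooth_gen_plane_cutoff.
have psi_0 x : ~ box (r + 1) x -> psi x = 0 by exact: plane_cutoff_eq0.
pose w s := expR (mu * s).
have PhiE s x : s <= b -> spacetime_cutoff mu b b' psi (s, x) = w s * psi x.
  by move=> sb; rewrite /spacetime_cutoff time_cutoffE//=; lra.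
have u2 (s : R) : 0 <= s <= b -> u s \in Lfun lebn 2%:E by move=> /inT /(energy_H1 sol)[].
have ut2 (s : R) : 0 <= s <= b -> ut s \in Lfun lebn 2%:E by move=> /inT /(energy_L2 sol).
have scal a f : f \in Lfun lebn 2%:E ->
    \int[lebn]_x (f x * (a * psi x)) = a * \int[lebn]_x (f x * psi x).
  move=> f2; under eq_Rintegral do rewrite mulrCA.
  by rewrite RintegralZl//; exact: L2_integrable_mul.
have sub (s : R) : s \in `[0, t]%classic -> 0 <= s <= b.
  rewrite inE/= in_itv/= => /andP[s0 st]; rewrite s0; exact: le_trans st tb'.
have := energy_weak sol (inT tb) (spacetime_cutoff_test mu bb' psig psi_0 b'T).
have -> : \int[lebn]_x (ut t x * spacetime_cutoff mu b b' psi (t, x)) = w t * G t.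
  by under eq_Rintegral do rewrite PhiE//; rewrite scal// ut2.
have -> : eps * \int[lebn]_x (u1 x * spacetime_cutoff mu b b' psi (0, x)) = G 0.
  under eq_Rintegral do rewrite PhiE// /w mulr0 expR0 mul1r.
  rewrite -RintegralZl//; last exact: L2_integrable_mul.
  apply: Rintegral_ae_eq.
  - apply: measurable_funM => //.
    exact: measurable_funM (L2_measurable hu1) (L2_measurable psi2).
  - have h0 : 0 <= (0 : R) <= b by rewrite lexx.
    exact: measurable_funM (L2_measurable (ut2 _ h0)) (L2_measurable psi2).
  - by apply: filterS (energy_init1 sol) => x ->; rewrite mulrA.
have -> : \int[leb1]_(s in `[0, t]) \int[lebn]_x (ut s x * dt (spacetime_cutoff mu b b' psi) s x) =
    \int[leb1]_(s in `[0, t]) (mu * w s * G s).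
  apply: eq_Rintegral => s /sub sb; rewrite -scal ?ut2//; apply: eq_Rintegral => x _.
  by rewrite dt_spacetime_cutoff//; case/andP: sb.
have -> : \int[leb1]_(s in `[0, t]) \int[lebn]_x
      (\sum_(i < m.+1) weak_gradient (u s) i x * dx i (spacetime_cutoff mu b b' psi) s x) =
    \int[leb1]_(s in `[0, t]) (- (w s * lam ^+ 2) * F s).
  apply: eq_Rintegral => s /sub sb; have [s0 sb'] := andP sb; have hs := inT sb.
  rewrite -(@weak_gradient_plane_cutoff _ _ _ _ _ (rad + s)).
  - apply: eq_Rintegral => x _; apply: eq_bigr => i _.
    by rewrite dx_spacetime_cutoff.
  - exact: (energy_H1 sol hs).
  - by rewrite /r; lra.
  - exact: (u_eq0_off_ball sol hs).
have -> : \int[leb1]_(s in `[0, t]) \int[lebn]_x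
      ((damping mu s * ut s x + mass nu s * u s x) * spacetime_cutoff mu b b' psi (s, x)) =
    \int[leb1]_(s in `[0, t]) (w s * (damping mu s * G s + mass nu s * F s)).
  apply: eq_Rintegral => s /sub sb; have [s0 sb'] := andP sb; have hs := inT sb.
  rewrite -!RintegralZl//; [|exact: L2_integrable_mul (u2 s sb) psi2|exact: L2_integrable_mul (ut2 s sb) psi2].
  rewrite -RintegralD//; last 2 first.
  - by apply: EFin_integrableZ => //; exact: L2_integrable_mul (ut2 s sb) psi2.
  - by apply: EFin_integrableZ => //; exact: L2_integrable_mul (u2 s sb) psi2.
  rewrite -RintegralZl//; last first.
    apply: EFin_integrableD => //; apply: EFin_integrableZ => //.
      exact: L2_integrable_mul (ut2 s sb) psi2.
    exact: L2_integrable_mul (u2 s sb) psi2.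
  apply: eq_Rintegral => x _; rewrite PhiE//; ring.
have tT : (t%:E < T)%E by apply: le_lt_trans bT; rewrite lee_fin.
have cG : {within `[0, t], continuous G} by exact: (pairing_ut_continuous sol psi2 tT).
have cF : {within `[0, t], continuous F} by exact: (pairing_u_continuous sol psi2 tT).
have win (f : R -> R) : (forall s : R, 0 <= s -> {for s, continuous f}) ->
    {within `[0, t], continuous f}.
  move=> cf; apply: continuous_in_subspaceT => s; rewrite inE /= in_itv /= => /andP[s0 _].
  exact: cf.
have cM (f g : R -> R) : {within `[0, t], continuous f} -> {within `[0, t], continuous g} ->
    {within `[0, t], continuous (fun s => f s * g s)}.
  by move=> cf cg s; exact: cvgM (cf s) (cg s).
have cw0 : continuous w.
  move=> s; apply: (@continuous_comp _ _ _ (fun s => mu * s) expR); last exact: continuous_expR.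
  by apply: cvgM; [exact: cvg_cst|exact: cvg_id].
have cw : {within `[0, t], continuous w} by exact: continuous_subspaceT.
have ck (k : R) : {within `[0, t], continuous (fun=> k)} by apply: win => s _; exact: cvg_cst.
have cr : {within `[0, t], continuous (fun s : R => (1 + s)^-1)}.
  by apply: win => s s0; apply: is_derive_continuous (is_derive_inv1 _); lra.
have cc : {within `[0, t], continuous c}.
  apply: (cM _ _); first exact: ck.
  apply: win => s s0; apply: (@continuous_comp _ _ _
    (fun s => - (p - 1) * (lam * s) - (p - 1) * (m%:R / 2) * ln (1 + s)) expR).
    apply: cvgB; apply: cvgM; [exact: cvg_cst| |exact: cvg_cst|].
      by apply: cvgM; [exact: cvg_cst|exact: cvg_id].
    by apply: is_derive_continuous (is_derive_ln1 _); lra.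
  exact: continuous_expR.
have cGp : {within `[0, t], continuous (fun s => c s * `|G s| `^ p)}.
  apply: (cM _ _) => // s; have h := continuous_normr_powR p1 (x := G s).
  exact: (@continuous_comp (subspace `[0, t]) _ _ G (fun y : R => `|y| `^ p) s (cG s) h).
have ci (f : R -> R) : {within `[0, t], continuous f} -> leb1.-integrable `[0, t] (EFin \o f).
  by move=> cf; apply: continuous_compact_integrable => //; exact: segment_compact.
have NL := nonlinear_term_ge t0 (energy_Lp_loc sol) tT cw0 (fun s => expR_ge0 (mu * s)) psig
  (@plane_cutoff_ge0 _ _ _ _) psi_0 cGp.
have {}NL : \int[leb1]_(s in `[0, t]) (w s * (c s * `|G s| `^ p)) <=
    \int[leb1]_(s in `[0, t]) \int[lebn]_x
      (`|ut s x| `^ p * spacetime_cutoff mu b b' psi (s, x)).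
  apply: le_trans (NL _ _) _.
  - by move=> s _; rewrite mulr_ge0 ?powR_ge0// mulr_ge0 ?powR_ge0 ?expR_ge0.
  - move=> s /andP[s0 st]; apply: nonlinear_pairing_ge.
    by rewrite s0 (le_trans st tb').
  rewrite le_eqVlt; apply/orP; left; apply/eqP.
  apply: eq_Rintegral => s /sub /andP[_ sb]; apply: eq_Rintegral => x _.
  by rewrite PhiE.
move=> weak; move: NL; rewrite -weak.
set I1 := \int[leb1]_(s in _) (mu * _ * _); set I2 := \int[leb1]_(s in _) (- _ * _).
set I3 := \int[leb1]_(s in _) (w s * (damping _ _ * _ + _)).
set I4 := \int[leb1]_(s in _) (w s * (c s * _)); set I := \int[leb1]_(s in _) _.
have c1 : leb1.-integrable `[0, t] (EFin \o (fun s => mu * w s * G s)).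
  by apply: ci; apply: (cM _ _) => //; apply: (cM _ _).
have c2 : leb1.-integrable `[0, t] (EFin \o (fun s => - (w s * lam ^+ 2) * F s)).
  apply: ci; rewrite (_ : (fun s => _) = fun s => w s * ((- lam ^+ 2) * F s)).
    by apply: (cM _ _) => //; apply: (cM _ _).
  by apply/funext => s; ring.
have c3 : leb1.-integrable `[0, t]
    (EFin \o (fun s => w s * (damping mu s * G s + mass nu s * F s))).
  apply: ci; apply: (cM w) => // s; apply: cvgD.
    by apply: (cM (fun s => damping mu s) G) => //; apply: (cM _ _).
  apply: (cM (fun s => mass nu s) F) => //; apply: (cM _ _) => //.
  rewrite (_ : (fun s => _) = fun s => (1 + s)^-1 * (1 + s)^-1); first exact: (cM _ _).
  by apply/funext => y; rewrite -exprVn.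
have c4 : leb1.-integrable `[0, t] (EFin \o (fun s => w s * (c s * `|G s| `^ p))).
  by apply: ci; exact: (cM _ _).
have -> : I = I1 - I2 - I3 + I4.
  rewrite /I1 /I2 /I3 /I4 -RintegralB// -RintegralB//; last exact: EFin_integrableB.
  rewrite -RintegralD//; last by apply: EFin_integrableB => //; exact: EFin_integrableB.
  by apply: eq_Rintegral => s _; rewrite /w /damping /mass exprVn; ring.
rewrite /w; lra.
Qed.

Let psi_rad := @plane_cutoff R m lam rad.

Lemma energy_blowup (P : R -> R) : 0 < eps ->
  {ae lebn, forall x, 0 <= u0 x} -> {ae lebn, forall x, 0 <= u1 x} ->
  0 < \int[lebn]_x (u0 x * psi_rad x) + \int[lebn]_x (u1 x * psi_rad x) ->
  (forall s : R, 1 <= s <= b -> is_derive s (1 : R) P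
    (expR (- ((p - 1) * (m%:R / 2) + (p - 1) * (mu / 2)) * ln (1 + s)))) ->
  1 <= b ->
  (p - 1) * (K `^ (1 - p) / (1 + 2 * lam + mu) `^ p) * (P b - P 1) <=
  (expR (- (`|mu * (mu - 2) / 4 - nu ^+ 2| / lam)) *
    (eps * (\int[lebn]_x (u0 x * psi_rad x) + \int[lebn]_x (u1 x * psi_rad x)))) `^ (1 - p).
Proof.
move=> eps0 u0_ge0 u1_ge0 J0 dP b1.
have rr : rad <= r by rewrite /r; lra.
have h0 : 0 <= (0 : R) <= b by rewrite lexx.
have t00 := inT h0.
have init (v v0 : space -> R) : v \in Lfun lebn 2%:E -> v0 \in Lfun lebn 2%:E ->
    ess_support v0 `<=` open_ball rad -> {ae lebn, forall x, v x = eps * v0 x} ->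
    \int[lebn]_x (v x * psi x) = eps * \int[lebn]_x (v0 x * psi_rad x).
  move=> v2 v02 sv vE; rewrite -(data_pairing_cutoff lam v02 sv rr).
  rewrite -RintegralZl//; last exact: L2_integrable_mul.
  apply: Rintegral_ae_eq.
  - exact: measurable_funM (L2_measurable v2) (L2_measurable psi2).
  - apply: measurable_funM => //.
    exact: measurable_funM (L2_measurable v02) (L2_measurable psi2).
  by apply: filterS vE => x ->; rewrite mulrA.
have F0 : F 0 = eps * \int[lebn]_x (u0 x * psi_rad x).
  by apply: (init _ _ (energy_H1 sol t00).1 hu0.1 su0); exact: energy_init0 sol.
have G0 : G 0 = eps * \int[lebn]_x (u1 x * psi_rad x).
  by apply: (init _ _ (energy_L2 sol t00) hu1 su1); exact: energy_init1 sol.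
rewrite [eps * (_ + _)]mulrDr -F0 -G0.
have cF : {within `[0, b], continuous F} by exact: (pairing_u_continuous sol psi2 bT).
have cG : {within `[0, b], continuous G} by exact: (pairing_ut_continuous sol psi2 bT).
have dF (s : R) : 0 < s < b -> is_derive s (1 : R) F (G s).
  move=> /andP[s0 sb]; apply: (pairing_u_derive sol psi2 s0).
  by apply: le_lt_trans bT; rewrite lee_fin ltW.
have F00 : 0 <= F 0.
  by rewrite F0; apply: mulr_ge0; [exact: ltW|exact: (data_pairing_ge0 lam hu0.1 u0_ge0 rad)].
have G00 : 0 <= G 0.
  by rewrite G0; apply: mulr_ge0; [exact: ltW|exact: (data_pairing_ge0 lam hu1 u1_ge0 rad)].
have FG0 : 0 < F 0 + G 0 by rewrite F0 G0 -mulrDr mulr_gt0.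
have K'0 : 0 < K `^ (1 - p) by rewrite powR_gt0.
exact: (@integral_blowup R mu (nu ^+ 2) lam p ((p - 1) * (m%:R / 2)) (K `^ (1 - p)) b F G
  mu0 (sqr_ge0 _) lam0 lamE p1 K'0 cF cG dF energy_inequality F00 G00 FG0 P dP b1).
Qed.

End energy_blowup.

(** * Bounds for the lifespan *)

Section lifespan.
Variable R : realType.

Lemma ball_volume_expR (m : nat) (lam rad : R) : 0 < lam -> 0 < rad ->
  exists2 K : R, 0 < K & forall s : R, 0 <= s ->
    (\int[lebesgue_rV R m.+1]_x
       (expR (lam * coord ord0 x) * \1_(open_ball (rad + s + 1)%R) x)%:E <=
     (K * expR (lam * s + m%:R / 2 * ln (1 + s)))%:E)%E.
Proof.
move=> lam0 rad0; have [C C0 hC] := ball_volume m lam0.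
exists (C * expR (lam * (rad + 1)) * Num.sqrt (rad + 1) ^+ m).
  by rewrite !mulr_gt0 ?expR_gt0// exprn_gt0// sqrtr_gt0; lra.
move=> s s0; have rho0 : 0 < rad + s + 1 by lra.
apply: le_trans (hC _ rho0) _; rewrite lee_fin expRD.
have -> : expR (m%:R / 2 * ln (1 + s)) = Num.sqrt (1 + s) ^+ m.
  rewrite -powR12_sqrt; last by lra.
  rewrite -powR_mulrn ?powR_ge0// -powRrM /powR gt_eqF; last by lra.
  by rewrite (mulrC 2^-1).
rewrite (_ : lam * (rad + s + 1) = lam * (rad + 1) + lam * s); last by ring.
rewrite expRD [leRHS](_ : _ = C * (expR (lam * (rad + 1)) * expR (lam * s)) *
  (Num.sqrt (rad + 1) ^+ m * Num.sqrt (1 + s) ^+ m)); last by ring.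
(* What remains is [rad + s + 1 <= (rad + 1) * (1 + s)], which separates the radius from the
   time. *)
rewrite ler_wpM2l ?mulr_ge0 ?expR_ge0 ?(ltW C0)// -exprMn -sqrtrM; last by lra.
rewrite lerXn2r ?nnegrE ?sqrtr_ge0// ler_sqrt; nra.
Qed.

Lemma ereal_le_of_itv (T : \bar R) (M : R) : 0 <= M ->
  (forall b : R, 0 <= b -> (b%:E < T)%E -> b <= M) -> (T <= M%:E)%E.
Proof.
move=> M0 hT; rewrite leNgt; apply/negP => MT.
have [b Mb bT] : exists2 b : R, M < b & (b%:E < T)%E.
  case: T MT {hT} => [x| |]//; last by exists (M + 1); rewrite ?ltry//; lra.
  by rewrite lte_fin => Mx; exists ((M + x) / 2); rewrite ?lte_fin; lra.
have b0 : 0 <= b by lra.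
by have := hT b b0 bT; rewrite leNgt Mb.
Qed.

Lemma powR_neg_ge1 (p eps : R) : 1 < p -> 0 < eps -> eps < 1 -> 1 <= eps `^ (- (p - 1)).
Proof.
move=> p1 eps0 eps1; rewrite powRN invf_ge1 ?powR_gt0//.
rewrite -[leRHS](congr1 (@^~ (p - 1)) (@powR1 R)).
by rewrite ge0_ler_powR ?nnegrE ?ltW// subr_gt0.
Qed.

End lifespan.

Section lifespan_bound.
Variables (R : realType) (m : nat) (p mu nu rad : R) (u0 u1 : 'rV[R]_m.+1 -> R).
Local Notation lebn := (lebesgue_rV R m.+1).
Hypotheses (p1 : 1 < p) (mu0 : 0 <= mu) (rad0 : 0 < rad)
  (hu0 : H1 u0) (hu1 : u1 \in Lfun lebn 2%:E)
  (u0_ge0 : {ae lebn, forall x, 0 <= u0 x}) (u1_ge0 : {ae lebn, forall x, 0 <= u1 x})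
  (hnz : ~ ({ae lebn, forall x, u0 x = 0} /\ {ae lebn, forall x, u1 x = 0}))
  (hsupp : ess_support u0 `|` ess_support u1 `<=` open_ball rad).
Let theta : R := (p - 1) * (m%:R / 2) + (p - 1) * (mu / 2).

(** [K], [lam] and the pairings of the data are fixed before [eps], the solution and [b], which
    makes [C] uniform. The dependence on [eps] comes out by homogeneity, [F 0] and [G 0] being
    multiples of [eps]. *)
Lemma primitive_bound (P : R -> R) :
  (forall s : R, 1 <= s -> is_derive s (1 : R) P (expR (- theta * ln (1 + s)))) ->
  exists2 C : R, 0 < C & forall (eps : R) u T (b : R), 0 < eps ->
    energy_solution p mu nu rad eps u0 u1 T u -> 1 <= b -> (b%:E < T)%E ->
    P b - P 1 <= C * eps `^ (- (p - 1)).
Proof.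
move=> dP; pose lam := Num.sqrt (nu ^+ 2 + 2 + mu).
have nu0 := sqr_ge0 nu.
have lam0 : 0 < lam by rewrite sqrtr_gt0; move: mu0 nu0; lra.
have lamE : lam ^+ 2 = nu ^+ 2 + 2 + mu by rewrite sqr_sqrtr//; move: mu0 nu0; lra.
have [K K0 ball_K] := ball_volume_expR m lam0 rad0.
have su0 : ess_support u0 `<=` open_ball rad by move=> x ux; apply: hsupp; left.
have su1 : ess_support u1 `<=` open_ball rad by move=> x ux; apply: hsupp; right.
pose J0 := \int[lebn]_x (u0 x * plane_cutoff lam rad x).
pose J1 := \int[lebn]_x (u1 x * plane_cutoff lam rad x).
have J00 : 0 <= J0 by exact: (data_pairing_ge0 lam hu0.1 u0_ge0 rad).
have J10 : 0 <= J1 by exact: (data_pairing_ge0 lam hu1 u1_ge0 rad).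
have J_gt0 : 0 < J0 + J1.
  rewrite lt_neqAle addr_ge0// andbT eq_sym paddr_eq0//; apply/negP => /andP[/eqP j0 /eqP j1].
  apply: hnz; split; [exact: (data_pairing_eq0 hu0.1 su0 u0_ge0 j0)|
    exact: (data_pairing_eq0 hu1 su1 u1_ge0 j1)].
pose k := (p - 1) * (K `^ (1 - p) / (1 + 2 * lam + mu) `^ p).
have k0 : 0 < k.
  rewrite /k mulr_gt0 ?divr_gt0 ?powR_gt0//; move: p1 mu0 lam0; lra.
pose e := expR (- (`|mu * (mu - 2) / 4 - nu ^+ 2| / lam)).
exists (k^-1 * (e * (J0 + J1)) `^ (1 - p)).
  by rewrite mulr_gt0 ?invr_gt0// powR_gt0// mulr_gt0// expR_gt0.
move=> eps u T b eps0 [T0 [ut sol]] b1 bT.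
have b0 : 0 <= b by lra.
have dPb (s : R) : 1 <= s <= b -> is_derive s (1 : R) P
    (expR (- ((p - 1) * (m%:R / 2) + (p - 1) * (mu / 2)) * ln (1 + s))).
  by move=> /andP[s1 _]; exact: dP.
have h : k * (P b - P 1) <= (e * (eps * (J0 + J1))) `^ (1 - p) :=
  energy_blowup p1 mu0 lam0 lamE K0 ball_K hu0 hu1 su0 su1 sol b0 bT eps0
    u0_ge0 u1_ge0 J_gt0 dPb b1.
have powE : (e * (eps * (J0 + J1))) `^ (1 - p) =
    (e * (J0 + J1)) `^ (1 - p) * eps `^ (- (p - 1)).
  rewrite opprB -powRM ?(ltW eps0) ?mulr_ge0 ?expR_ge0 ?(ltW J_gt0)//.
  by congr (_ `^ _); ring.
by rewrite -mulrA ler_pdivlMl// -powE.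
Qed.

(** With [a = 1 - theta], [P s] is [(1 + s) ^ a / a]. The term [2 ^ a] in the bound stands for [P 1]
    and also covers [b < 1]. For [eps < 1] it is absorbed in the constant, because then
    [eps ^ (- (p - 1)) >= 1]. *)
Lemma lifespan_subcritical : theta < 1 ->
  (forall (eps : R) u T, 0 < eps -> energy_solution p mu nu rad eps u0 u1 T u -> (T < +oo)%E) /\
  exists2 C : R, 0 < C & forall (eps : R) u T, 0 < eps -> eps < 1 ->
    energy_solution p mu nu rad eps u0 u1 T u ->
    (T <= (C * eps `^ (- ((p - 1) / (1 - theta))))%:E)%E.
Proof.
move=> th1; have a0 : 0 < 1 - theta by rewrite subr_gt0.
set a := 1 - theta in a0 *.
pose P (s : R) := a^-1 * expR (a * ln (1 + s)).
have dP (s : R) : 1 <= s -> is_derive s (1 : R) P (expR (- theta * ln (1 + s))).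
  move=> s1; have h : is_derive s (1 : R) (fun s => a * ln (1 + s)) (a * (1 + s)^-1).
    by apply: is_derive_mulc; apply: is_derive_ln1; lra.
  have := is_derive_mulc a^-1 (is_derive_expR_comp h).
  move=> {}h; apply: is_derive_eq h _; rewrite -/a.
  rewrite (_ : - theta * ln (1 + s) = a * ln (1 + s) - ln (1 + s)); last by rewrite /a; ring.
  rewrite expRB lnK ?posrE; last by lra.
  by field; rewrite (gt_eqF a0); apply/andP; split=> //; rewrite gt_eqF; lra.
have [C C0 hC] := primitive_bound dP.
have key (eps : R) u T (b : R) : 0 < eps -> energy_solution p mu nu rad eps u0 u1 T u ->
    0 <= b -> (b%:E < T)%E ->
    b <= (2 `^ a + a * C * eps `^ (- (p - 1))) `^ a^-1.
  move=> eps0 sol b0 bT.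
  have E0 := powR_ge0 eps (- (p - 1)).
  have h : (1 + b) `^ a <= 2 `^ a + a * C * eps `^ (- (p - 1)).
    have [b1|b1] := lerP 1 b.
      have := hC eps u T b eps0 sol b1 bT.
      rewrite /P -mulrBr -ler_pdivlMl ?invr_gt0// invrK.
      rewrite /powR !gt_eqF//; [|by lra]; rewrite -natr1 (_ : 1%:R + 1 = 1 + 1 :> R)//.
      by rewrite mulrA lerBlDl.
    apply: (@le_trans _ _ (2 `^ a)).
      by rewrite ge0_ler_powR ?nnegrE ?(ltW a0)//; lra.
    by rewrite lerDl !mulr_ge0// ltW.
  apply: (@le_trans _ _ (1 + b)); first by lra.
  rewrite (_ : 1 + b = ((1 + b) `^ a) `^ a^-1); last first.
    by rewrite -powRrM divff ?lt0r_neq0// powRr1//; lra.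
  by rewrite ge0_ler_powR ?invr_ge0 ?(ltW a0) ?nnegrE ?powR_ge0//; exact: le_trans (powR_ge0 _ _) h.
split=> [eps u T eps0 sol|].
  apply: (@le_lt_trans _ _ ((2 `^ a + a * C * eps `^ (- (p - 1))) `^ a^-1)%:E); last exact: ltry.
  by apply: ereal_le_of_itv => [|b b0 bT]; [exact: powR_ge0|exact: key sol b0 bT].
have D0 : 0 < 2 `^ a + a * C by rewrite addr_gt0 ?powR_gt0// mulr_gt0.
exists ((2 `^ a + a * C) `^ a^-1) => [|eps u T eps0 eps1 sol]; first exact: powR_gt0.
apply: ereal_le_of_itv => [|b b0 bT]; first by rewrite mulr_ge0 ?powR_ge0.
apply: le_trans (key _ _ _ _ eps0 sol b0 bT) _.
rewrite -mulNr powRrM -powRM ?powR_ge0 ?(ltW D0)//.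
rewrite ge0_ler_powR ?invr_ge0 ?(ltW a0) ?nnegrE ?mulr_ge0 ?addr_ge0 ?mulr_ge0 ?powR_ge0 ?(ltW D0) ?(ltW a0) ?(ltW C0)//.
by rewrite [leRHS]mulrDl lerD2r ler_peMr ?powR_ge0// powR_neg_ge1.
Qed.

(** Here the primitive is [ln (1 + s)]. Its value at 1 is at most 1, which gives the summand 1 in
    the exponent; for [eps < 1] this goes into the constant [1 + C]. *)
Lemma lifespan_critical : theta = 1 ->
  (forall (eps : R) u T, 0 < eps -> energy_solution p mu nu rad eps u0 u1 T u -> (T < +oo)%E) /\
  exists2 C : R, 0 < C & forall (eps : R) u T, 0 < eps -> eps < 1 ->
    energy_solution p mu nu rad eps u0 u1 T u ->
    (T <= (expR (C * eps `^ (- (p - 1))))%:E)%E.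
Proof.
move=> th1; pose P (s : R) := ln (1 + s).
have dP (s : R) : 1 <= s -> is_derive s (1 : R) P (expR (- theta * ln (1 + s))).
  move=> s1; rewrite th1 mulN1r expRN lnK ?posrE; last by lra.
  by apply: is_derive_ln1; lra.
have [C C0 hC] := primitive_bound dP.
have key (eps : R) u T (b : R) : 0 < eps -> energy_solution p mu nu rad eps u0 u1 T u ->
    0 <= b -> (b%:E < T)%E -> b <= expR (1 + C * eps `^ (- (p - 1))).
  move=> eps0 sol b0 bT.
  have CE0 : 0 <= C * eps `^ (- (p - 1)) by rewrite mulr_ge0 ?powR_ge0// ltW.
  have ln2 : ln (1 + 1 : R) <= 1.
    have := @le_ln1Dx R 1; move=> h; apply: h; lra.
  have [b1|b1] := lerP 1 b; last first.
    by have := expR_ge1Dx (1 + C * eps `^ (- (p - 1))); lra.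
  have := hC eps u T b eps0 sol b1 bT; rewrite /P => h.
  apply: (@le_trans _ _ (1 + b)); first by lra.
  rewrite -[leLHS]lnK ?posrE; last by lra.
  by rewrite ler_expR; lra.
split=> [eps u T eps0 sol|].
  apply: (@le_lt_trans _ _ (expR (1 + C * eps `^ (- (p - 1))))%:E); last exact: ltry.
  by apply: ereal_le_of_itv => [|b b0 bT]; [exact: expR_ge0|exact: key sol b0 bT].
exists (1 + C) => [|eps u T eps0 eps1 sol]; first by lra.
apply: ereal_le_of_itv => [|b b0 bT]; first exact: expR_ge0.
apply: le_trans (key _ _ _ _ eps0 sol b0 bT) _; rewrite ler_expR mulrDl mul1r lerD2r.
exact: powR_neg_ge1.
Qed.

End lifespan_bound.
Theorem corollary2p8 (R : realType) (n : nat) (p mu nu rad : R)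
    (u0 u1 : 'rV[R]_n -> R)
    (hn : (1 <= n)%N) (hp : 1 < p) (hmu : 0 <= mu) (hnu : 0 <= nu ^+ 2)
    (hrad : 0 < rad)
    (hu0 : H1 u0) (hu1 : u1 \in Lfun (lebesgue_rV R n) 2%:E)
    (hu0_ge0 : {ae lebesgue_rV R n, forall x, 0 <= u0 x})
    (hu1_ge0 : {ae lebesgue_rV R n, forall x, 0 <= u1 x})
    (hu0_cpt : compact (ess_support u0)) (hu1_cpt : compact (ess_support u1))
    (hnz : ~ ({ae lebesgue_rV R n, forall x, u0 x = 0} /\
              {ae lebesgue_rV R n, forall x, u1 x = 0}))
    (hsupp : ess_support u0 `|` ess_support u1 `<=` open_ball rad) :
  (1 < n%:R + mu -> p <= glassey (n%:R + mu) ->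
    (forall (eps : R) (u : R -> 'rV[R]_n -> R) (T : \bar R), 0 < eps ->
       has_lifespan p mu nu rad eps u0 u1 u T -> (T < +oo)%E) /\
    (exists C eps0 : R, [/\ 0 < C, 0 < eps0 &
       forall (eps : R) (u : R -> 'rV[R]_n -> R) (T : \bar R),
         0 < eps -> eps < eps0 ->
         has_lifespan p mu nu rad eps u0 u1 u T ->
         (p < glassey (n%:R + mu) ->
            (T <= (C * eps `^ (- (2 * (p - 1)
                     / (2 - (n%:R + mu - 1) * (p - 1)))))%:E)%E) /\
         (p = glassey (n%:R + mu) ->
            (T <= (expR (C * eps `^ (- (p - 1))))%:E)%E)]))
  /\
  (n = 1%N -> mu = 0 ->
    (forall (eps : R) (u : R -> 'rV[R]_n -> R) (T : \bar R), 0 < eps ->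
       has_lifespan p mu nu rad eps u0 u1 u T -> (T < +oo)%E) /\
    (exists C eps0 : R, [/\ 0 < C, 0 < eps0 &
       forall (eps : R) (u : R -> 'rV[R]_n -> R) (T : \bar R),
         0 < eps -> eps < eps0 ->
         has_lifespan p mu nu rad eps u0 u1 u T ->
         (T <= (C * eps `^ (- (p - 1)))%:E)%E])).
Proof.
case: n hn => // m _ in u0 u1 hu0 hu1 hu0_ge0 hu1_ge0 hu0_cpt hu1_cpt hnz hsupp *.
(* Here [n] is [m.+1], so [theta = (n + mu - 1) * (p - 1) / 2], and [p] lies below or at the Glassey
   exponent according as [theta < 1] or [theta = 1]. *)
pose theta := (p - 1) * (m%:R / 2) + (p - 1) * (mu / 2).
have sub := @lifespan_subcritical R m p mu nu rad u0 u1 hp hmu hrad hu0 hu1 hu0_ge0 hu1_ge0 hnz hsupp.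
have crit := @lifespan_critical R m p mu nu rad u0 u1 hp hmu hrad hu0 hu1 hu0_ge0 hu1_ge0 hnz hsupp.
split=> [d1|m0 muE].
  have dE : m.+1%:R + mu - 1 = m%:R + mu by rewrite -natr1; ring.
  have d0 : 0 < m%:R + mu by rewrite -dE subr_gt0.
  have thE : theta = (p - 1) * ((m%:R + mu) / 2) by rewrite /theta; ring.
  rewrite /glassey dE le_eqVlt => /orP[/eqP pE|pltg].
    have th1 : theta = 1.
      by rewrite thE pE addrC addKr; field; rewrite gt_eqF.
    have [fin [C C0 hC]] := crit th1.
    split=> [eps u T eps0 [sol _]|]; first exact: fin eps0 sol.
    exists C, 1; split=> // eps u T eps0 eps1 [sol _]; split=> [|_].
      by rewrite pE ltxx.
    exact: (hC eps u T eps0 eps1 sol).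
  have th1 : theta < 1.
    rewrite thE mulrA ltr_pdivrMr// mul1r -ltr_pdivlMr//; move: pltg; lra.
  have [fin [C C0 hC]] := sub th1.
  split=> [eps u T eps0 [sol _]|]; first exact: fin eps0 sol.
  exists C, 1; split=> // eps u T eps0 eps1 [sol _]; split=> [_|pE]; last first.
    by move: pltg; rewrite -pE ltxx.
  have th0 : 1 - theta != 0 by rewrite gt_eqF// subr_gt0.
  rewrite (_ : 2 * (p - 1) / (2 - (m%:R + mu) * (p - 1)) = (p - 1) / (1 - theta)).
    exact: (hC eps u T eps0 eps1 sol).
  (* The denominator of the stated exponent is [2 * (1 - theta)]. *)
  rewrite (_ : 2 - (m%:R + mu) * (p - 1) = 2 * (1 - theta)); last by rewrite thE; field.
  by field.
(* In dimension one without damping [theta] vanishes for every [p]: the case is always subcritical,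
   and the exponent [(p - 1) / (1 - theta)] is [p - 1]. *)
have th0 : theta = 0 by case: m0 => m0; rewrite /theta m0 muE; ring.
have th1 : theta < 1 by rewrite th0.
have [fin [C C0 hC]] := sub th1.
split=> [eps u T eps0 [sol _]|]; first exact: fin eps0 sol.
exists C, 1; split=> // eps u T eps0 eps1 [sol _].
have := hC eps u T eps0 eps1 sol.
by rewrite -/theta th0 subr0 divr1.
Qed.
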